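(* The function $a\mapsto C_\infty(a)$, defined on smooth damping terms $a:M\to\mathscr H_n^+(\mathbf C)$, is in general neither homogeneous nor monotonous. More precisely: there exist $(M,g)$, $n$ and a smooth damping term $a$ with $C_\infty(2a)<C_\infty(a)$, and there exist $(M,g)$, $n$ and a smooth damping term $a$ with $2C_\infty(a)<C_\infty(2a)$. It is also not additive: there exist $(M,g)$, $n$ and smooth damping terms $a,b$ with $C_\infty(a+b)>C_\infty(a)+C_\infty(b)$, and there exist $(M,g)$, $n$ and smooth damping terms $a,b$ with $C_\infty(a+b)<C_\infty(a)+C_\infty(b)$.
   Context: $(M,g)$ denotes a smooth, connected, compact Riemannian manifold without boundary, $n\ge1$ an integer, and $\mathscr H_n^+(\mathbf C)$ the set of positive-semidefinite Hermitian $n\times n$ complex matrices. A damping term is a smooth map $a:M\to\mathscr H_n^+(\mathbf C)$. Monotonicity refers to the pointwise order of Hermitian matrices. Let $S^*M=\{(x,\xi)\in T^*M:|\xi|_g=1/2\}$, let $\phi$ be the geodesic flow on $S^*M$ (the Hamiltonian flow generated by $|\xi|_g^2$), and write $(x_t,\xi_t)=\phi_t(x_0,\xi_0)$. For $(x_0,\xi_0)\in S^*M$ let $G_t^+(x_0,\xi_0)\in\mathscr M_n(\mathbf C)$ be the solution of $G_0^+(x_0,\xi_0)=\mathrm{Id}_n$, $\partial_tG_t^+(x_0,\xi_0)=-a(x_t)G_t^+(x_0,\xi_0)$. With $\|\cdot\|_2$ the operator norm associated with the Euclidean norm on $\mathbf C^n$, $$C_\infty(a)=\lim_{t\to\infty}\frac{-1}{t}\sup_{(x_0,\xi_0)\in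 S^*M}\ln\big(\|G_t^+(x_0,\xi_0)\|_2\big)$$ (this limit exists). *)

(* Defs.v *)
From HB Require Import structures.
From mathcomp Require Import all_boot all_order all_algebra.
From mathcomp Require Import all_classical all_reals all_analysis.
From mathcomp Require Import complex.

Set Implicit Arguments.
Unset Strict Implicit.
Unset Printing Implicit Defensive.

Import Order.TTheory GRing.Theory Num.Theory.
Import numFieldNormedType.Exports.

Local Open Scope classical_set_scope.
Local Open Scope ring_scope.
Local Open Scope sesquilinear_scope.

(* [f] is C^k on the open set [V]: [f] is continuous on [V] and, if k > 0, its
   first partial derivatives exist on [V] and are of class C^(k-1) there. *)
Fixpoint class_C (R : realType) (d : nat) (W : normedModType R) (k : nat)
    (V : set 'rV[R]_d) (f : 'rV[R]_d -> W) : Prop :=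
  (forall y, V y -> {for y, continuous f}) /\
  if k is k'.+1 then
    forall l : 'I_d,
      (forall y, V y -> derivable f y (delta_mx 0 l)) /\
      class_C k' V ('D_(delta_mx 0 l) f)
  else True.

Definition smooth_on (R : realType) (d : nat) (W : normedModType R)
    (V : set 'rV[R]_d) (f : 'rV[R]_d -> W) : Prop :=
  forall k, class_C k V f.

(* The differentiable structure is a smooth atlas.  [chart i] and
   [chart_inv i] are total functions, meaningful only on [chart_dom i] and on
   its image.  Dimension 0 is excluded: the cosphere bundle of a point is
   empty. *)
Record smoothManifold (R : realType) := SmoothManifold {
  carrier :> topologicalType;
  mdim : nat;
  mdim_gt0 : (0 < mdim)%N;
  carrier_hausdorff : hausdorff_space carrier;
  carrier_second_countable : @second_countable carrier;
  chart_index : Type;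
  chart_dom : chart_index -> set carrier;
  chart : chart_index -> carrier -> 'rV[R]_mdim;
  chart_inv : chart_index -> 'rV[R]_mdim -> carrier;
  chart_dom_open : forall i, open (chart_dom i);
  chart_cod_open : forall i, open (chart i @` chart_dom i);
  chartK : forall i x, chart_dom i x -> chart_inv i (chart i x) = x;
  chart_continuous : forall i x, chart_dom i x -> {for x, continuous (chart i)};
  chart_inv_continuous : forall i y, (chart i @` chart_dom i) y ->
    {for y, continuous (chart_inv i)};
  chart_cover : forall x, exists i, chart_dom i x;
  transition_smooth : forall i j,
    smooth_on (chart i @` (chart_dom i `&` chart_dom j))
      (chart j \o chart_inv i)
}.

Definition chart_cod (R : realType) (M : smoothManifold R)
    (i : chart_index M) : set 'rV[R]_(mdim M) := chart i @` chart_dom i.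

(* Row-vector convention: 'J f y has the entry d_k f_l at position (k, l). *)
Definition transition_jacobian (R : realType) (M : smoothManifold R)
    (i j : chart_index M) (x : M) : 'M[R]_(mdim M) :=
  'J (chart j \o chart_inv i) (chart i x).

(* [metric i y] is the Gram matrix of g in the coordinates of the chart i. *)
Record closedRiemannianManifold (R : realType) := ClosedRiemannianManifold {
  manifold :> smoothManifold R;
  manifold_nonempty : [set: manifold] !=set0;
  manifold_compact : compact [set: manifold];
  manifold_connected : connected [set: manifold];
  metric : chart_index manifold ->
    'rV[R]_(mdim manifold) -> 'M[R]_(mdim manifold);
  metric_smooth : forall i, smooth_on (chart_cod i) (metric i);
  metric_sym : forall i y, chart_cod i y -> (metric i y)^T = metric i y;
  metric_pos : forall i y, chart_cod i y ->
    forall v : 'rV[R]_(mdim manifold), v != 0 ->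
      0 < (v *m metric i y *m v^T) 0 0;
  metric_compat : forall i j x, chart_dom i x -> chart_dom j x ->
    metric i (chart i x) = transition_jacobian i j x
                           *m metric j (chart j x)
                           *m (transition_jacobian i j x)^T
}.

(* A covector is given by its components in all the charts around its base
   point; its components in the other charts are set to 0. *)
Definition covector_family (R : realType) (M : smoothManifold R) : Type :=
  (M * (chart_index M -> 'rV[R]_(mdim M)))%type.

Definition cotangent_bundle (R : realType) (M : smoothManifold R)
    : set (covector_family M) :=
  [set rho | (forall i j, chart_dom i rho.1 -> chart_dom j rho.1 ->
                rho.2 i = rho.2 j *m (transition_jacobian i j rho.1)^T) /\
             (forall i, ~ chart_dom i rho.1 -> rho.2 i = 0)].

(* |xi|_g ^ 2 at the point of coordinates (y, p) in the chart i *)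
Definition hamiltonian (R : realType) (M : closedRiemannianManifold R)
    (i : chart_index M) (y p : 'rV[R]_(mdim M)) : R :=
  (p *m invmx (metric i y) *m p^T) 0 0.

Definition cosphere_bundle (R : realType) (M : closedRiemannianManifold R)
    : set (covector_family M) :=
  [set rho | @cotangent_bundle R M rho /\
     forall i, chart_dom i rho.1 ->
       Num.sqrt (hamiltonian i (chart i rho.1) (rho.2 i)) = 2^-1].

(* Integral curves of the Hamiltonian vector field of |xi|_g ^ 2:
   y' = dH/dp and p' = - dH/dy in every chart. *)
Definition hamiltonian_curve (R : realType) (M : closedRiemannianManifold R)
    (gamma : R -> covector_family M) : Prop :=
  [/\ forall t, @cotangent_bundle R M (gamma t),
      continuous (fun t => (gamma t).1 : M) &
      forall t i, chart_dom i (gamma t).1 ->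
        let y := chart i (gamma t).1 in
        let p := (gamma t).2 i in
        is_derive t 1 (fun s => chart i (gamma s).1)
          (\row_k 'D_(delta_mx 0 k) (fun q => hamiltonian i y q) p) /\
        is_derive t 1 (fun s => (gamma s).2 i)
          (- \row_k 'D_(delta_mx 0 k) (fun z => hamiltonian i z p) y)].

(* The default value of [xget] is never used when gamma 0 is in the cotangent
   bundle: closed manifolds are geodesically complete, and the integral curve
   is unique. *)
Definition geodesic_flow (R : realType) (M : closedRiemannianManifold R)
    (t : R) (rho : covector_family M) : covector_family M :=
  xget (fun=> rho)
    [set gamma | @hamiltonian_curve R M gamma /\ gamma 0 = rho] t.

Definition psd (R : realType) (n : nat) (A : 'M[R[i]]_n) : Prop :=
  A \is hermsymmx /\ forall v : 'cV[R[i]]_n, 0 <= (v ^t* *m A *m v) 0 0.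

Definition smooth_function (R : realType) (M : smoothManifold R)
    (f : M -> R) : Prop :=
  forall i : chart_index M, smooth_on (chart_cod i) (f \o chart_inv i).

Definition damping (R : realType) (M : closedRiemannianManifold R) (n : nat)
    (a : M -> 'M[R[i]]_n) : Prop :=
  (forall x, psd (a x)) /\
  forall k l, smooth_function (fun x => complex.Re (a x k l)) /\
              smooth_function (fun x => complex.Im (a x k l)).

Definition is_derive_cmx (R : realType) (n : nat) (F : R -> 'M[R[i]]_n)
    (t : R) (D : 'M[R[i]]_n) : Prop :=
  forall k l,
    is_derive t (1 : R) (fun s => complex.Re (F s k l)) (complex.Re (D k l)) /\
    is_derive t (1 : R) (fun s => complex.Im (F s k l)) (complex.Im (D k l)).

Definition Gplus (R : realType) (M : closedRiemannianManifold R) (n : nat)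
    (a : M -> 'M[R[i]]_n) (t : R) (rho : covector_family M) : 'M[R[i]]_n :=
  xget (fun=> 1%:M)
    [set G : R -> 'M[R[i]]_n | G 0 = 1%:M /\
       forall s, is_derive_cmx G s (- (a (geodesic_flow s rho).1 *m G s))] t.

Definition enorm (R : realType) (n : nat) (v : 'cV[R[i]]_n) : R :=
  Num.sqrt (\sum_k (complex.Re (v k 0) ^+ 2 + complex.Im (v k 0) ^+ 2)).

Definition opnorm2 (R : realType) (n : nat) (A : 'M[R[i]]_n) : R :=
  sup [set enorm (A *m v) | v in [set v : 'cV[R[i]]_n | enorm v <= 1]].

(* The limit exists and, for t > 0, the supremum is that of a nonempty bounded
   set, so the conventional values of [lim], [sup] and [ln] do not matter. *)
Definition C_infty (R : realType) (M : closedRiemannianManifold R) (n : nat)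
    (a : M -> 'M[R[i]]_n) : R :=
  lim ((- 1 / t * sup [set ln (opnorm2 (Gplus a t rho)) |
                        rho in @cosphere_bundle R M]) @[t --> +oo]).

Definition C_infty_homogeneous (R : realType)
    (M : closedRiemannianManifold R) (n : nat) : Prop :=
  forall (c : R) (a : M -> 'M[R[i]]_n), 0 <= c -> damping a ->
    C_infty (fun x => c%:C%C *: a x) = c * C_infty a.

Definition damping_le (R : realType) (M : closedRiemannianManifold R)
    (n : nat) (a b : M -> 'M[R[i]]_n) : Prop :=
  forall x, psd (b x - a x).

(* monotone in either direction, for the pointwise order of Hermitian matrices *)
Definition C_infty_monotone (R : realType)
    (M : closedRiemannianManifold R) (n : nat) : Prop :=
  (forall a b : M -> 'M[R[i]]_n, damping a -> damping b -> damping_le a b ->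
     C_infty a <= C_infty b) \/
  (forall a b : M -> 'M[R[i]]_n, damping a -> damping b -> damping_le a b ->
     C_infty b <= C_infty a).

Definition C_infty_additive (R : realType)
    (M : closedRiemannianManifold R) (n : nat) : Prop :=
  forall a b : M -> 'M[R[i]]_n, damping a -> damping b ->
    C_infty (fun x => a x + b x) = C_infty a + C_infty b.

(* Main.v *)
Require Import Defs.
From HB Require Import structures.
From mathcomp Require Import all_boot all_order all_algebra.
From mathcomp Require Import all_classical all_reals all_analysis.
From mathcomp Require Import complex ring lra.

Set Implicit Arguments.
Unset Strict Implicit.
Unset Printing Implicit Defensive.

Import Order.TTheory GRing.Theory Num.Theory.
Import numFieldNormedType.Exports.

Local Open Scope classical_set_scope.
Local Open Scope ring_scope.

(** Everything happens on the circle of length 2 pi, where the time-t geodesic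
    from the angle theta with covector c is theta + 2 c t, hence a motion of
    speed one in one of the two directions on the cosphere bundle
    ([geodesic_flow_circle]).  With a linear ODE along a periodic orbit, a
    damping decays at the rate read off from its monodromy, and the trick is to
    choose dampings for which the ODE has constant coefficients in a rotating
    frame.

    Let K be a real antisymmetric matrix with K^3 = - K, so that
    U(theta) = exp(theta K) = 1 + sin theta K + (1 - cos theta) K^2 is
    2 pi-periodic, and let a(theta) = U(theta) D U(theta)^-1 with D = s L L^T
    real and positive semidefinite.  Then
      G_t = U(theta + e t) exp(- t (D + e K)) U(theta)^-1,  e = 1 or -1,
    and D - K is the transpose of D + K, so both directions decay alike and
    C_infty(a) is the smallest real part of the eigenvalues of D + K
    ([C_infty_rotating], [C_infty_rotating_gram]).  Multiplying a by c replaces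
    D + K by c D + K: the part D that dissipates is scaled, the part K that
    stirs is not.  Two competing effects then break homogeneity in the two
    directions.

    Overdamping.  In a plane, the eigenvalues of c D + K are
    c tr(D)/2 +- sqrt(c^2 delta^2 - 1) with delta half the gap of D.  Just after
    they have become real the smaller one decreases with c: K no longer stirs
    the weakly damped direction fast enough.  [overdamped_factor] gives
    rates 0, 2/3 and 1/3 for c = 0, 1, 2.  This provides at once
    C_infty(2a) < C_infty(a), the failure of additivity from below for the
    pair (a, a), and, since 0 <= a <= 2a, the failure of monotonicity in both
    directions.

    Superlinearity.  In dimension three, with K the rotation of the last two
    coordinates, the mean of a over the circle is block diagonal and the first
    coordinate, which K does not move, is damped at the rate
    D_11 at first order.  It is coupled to the plane that K rotates, where
    the average damping is larger, and the coupling contributes at third order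
    in c with a sign that can be made positive.  For [superlinear_factor], of
    rank one, the rates are 1/7 for c = 1 and 10/21 > 2/7 for c = 2.  This
    provides 2 C_infty(a) < C_infty(2a) and, again with the pair (a, a), the
    failure of additivity from above. *)

(** * Smooth functions of one coordinate *)

Section RowVector1.
Variable R : realType.

(** The curve h |-> y + h e_0 has h + y_0 as its coordinate, so the partial
    derivative in the sense of row vectors is literally the derivative on the
    line: the two difference quotients are the same function of h. *)
Lemma growth_rate_coord (W : normedModType R) (f : R -> W) (y : 'rV[R]_1) :
  (fun h : R => h^-1 *: (((fun v : 'rV[R]_1 => f (v 0 0)) \o shift y)
     (h *: delta_mx 0 0) - f (y 0 0)))
  = (fun h : R => h^-1 *: ((f \o shift (y 0 0)) (h *: 1) - f (y 0 0))).
Proof. by apply/funext => h; rewrite /= !mxE eqxx. Qed.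

Lemma derivable_coord (W : normedModType R) (f : R -> W) (y : 'rV[R]_1) :
  derivable (fun v : 'rV[R]_1 => f (v 0 0)) y (delta_mx 0 0) =
  derivable f (y 0 0) 1.
Proof. by rewrite /derivable growth_rate_coord. Qed.

Lemma derive_coord (W : normedModType R) (f : R -> W) (y : 'rV[R]_1) :
  'D_(delta_mx 0 0) (fun v : 'rV[R]_1 => f (v 0 0)) y = 'D_1 f (y 0 0).
Proof. by rewrite /derive growth_rate_coord. Qed.

Lemma continuous_coord (y : 'rV[R]_1) :
  {for y, continuous (fun v : 'rV[R]_1 => v 0 0)}.
Proof. exact: coord_continuous. Qed.

(** The induction needs the equality on an open set: the derivatives of f and g
    agree only where f and g agree on a neighbourhood. *)
Lemma class_C_eq (d : nat) (W : normedModType R) k (V : set 'rV[R]_d)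
    (f g : 'rV[R]_d -> W) :
  open V -> (forall y, V y -> f y = g y) -> class_C k V g -> class_C k V f.
Proof.
move=> oV; have nV y : V y -> \forall z \near y, V z.
  by move=> Vy; exact: open_nbhs_nbhs.
elim: k f g => [|k IH] f g fg [cg Dg].
  split=> // y Vy; rewrite /prop_for /continuous_at (fg y Vy).
  have gf : {near y, g =1 f} by apply: filterS (nV y Vy) => z Vz; exact/esym/fg.
  exact: cvg_trans (near_eq_cvg gf) (cg y Vy).
split=> [y Vy|l].
  rewrite /prop_for /continuous_at (fg y Vy).
  have gf : {near y, g =1 f} by apply: filterS (nV y Vy) => z Vz; exact/esym/fg.
  exact: cvg_trans (near_eq_cvg gf) (cg y Vy).
have [dg D'g] := Dg l; split=> [y Vy|].
  apply: (near_eq_derivable _ (dg y Vy)).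
  by apply: filterS (nV y Vy) => z Vz; exact/esym/fg.
apply: IH D'g => y Vy; apply: near_eq_derive => //.
by apply: filterS (nV y Vy) => z Vz; exact/fg.
Qed.

Lemma class_C_cst (d : nat) (W : normedModType R) k (V : set 'rV[R]_d) (c : W) :
  class_C k V (fun=> c).
Proof.
elim: k c => [|k IH] c; split=> //; try by move=> y _; exact: cst_continuous.
move=> l.
split=> [y _|]; first exact: derivable_cst.
have -> : 'D_(delta_mx 0 l) (fun _ : 'rV[R]_d => c) = (fun=> 0).
  by apply/funext => y; exact: derive_cst.
exact: IH.
Qed.

(** Smoothness by invariance: a set of functions of the line that contains a
    derivative of each of its members consists of smooth functions. *)
Lemma smooth_coord (W : normedModType R) (S : set (R -> W)) :
  (forall f, S f -> exists2 f', S f' & forall t : R, is_derive t 1 f (f' t)) ->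
  forall (f : R -> W) (V : set 'rV[R]_1), S f -> smooth_on V (fun v => f (v 0 0)).
Proof.
move=> SD f V Sf k; elim: k f Sf => [|k IH] f Sf; have [f' Sf' ff'] := SD f Sf;
  have cf (y : 'rV[R]_1) : {for y, continuous (fun v : 'rV[R]_1 => f (v 0 0))}.
- apply: (@continuous_comp _ _ _ (fun v : 'rV[R]_1 => v 0 0) f).
    exact: coord_continuous.
  apply: differentiable_continuous; apply/derivable1_diffP.
  by case: (ff' (y 0 0)).
- by split.
- apply: (@continuous_comp _ _ _ (fun v : 'rV[R]_1 => v 0 0) f).
    exact: coord_continuous.
  apply: differentiable_continuous; apply/derivable1_diffP.
  by case: (ff' (y 0 0)).
split=> // l; rewrite ord1; split=> [y _|].
  by rewrite derivable_coord; case: (ff' (y 0 0)).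
have -> : 'D_(delta_mx 0 0) (fun v : 'rV[R]_1 => f (v 0 0)) = (fun v => f' (v 0 0)).
  by apply/funext => y; rewrite derive_coord; case: (ff' (y 0 0)).
exact: IH.
Qed.

End RowVector1.

(** * The angle of a point of the unit circle *)

Section Angle.
Variable R : realType.
Implicit Types x y t : R.

(** The half-angle formula gives the angle in ]-pi, pi[ of every point (x, y) of
    the unit circle but (-1, 0), and it is visibly continuous there. *)
Definition angle x y : R := 2 * atan (y / (1 + x)).

Lemma angle_gtNpi x y : - pi < angle x y.
Proof. by have := atan_gtNpi2 (y / (1 + x)); rewrite /angle; lra. Qed.

Lemma angle_ltpi x y : angle x y < pi.
Proof. by have := atan_ltpi2 (y / (1 + x)); rewrite /angle; lra. Qed.

Lemma half_angle t : cos t = 2 * cos (t / 2) ^+ 2 - 1 /\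
  sin t = 2 * cos (t / 2) * sin (t / 2).
Proof.
have {1 3}-> : t = t / 2 *+ 2 by rewrite -mulr_natr divfK.
by rewrite cos_mulr2n sin_mulr2n; split; ring.
Qed.

Lemma onePcos_gt0 t : - pi < t < pi -> 0 < 1 + cos t.
Proof.
move=> /andP[t1 t2]; have [-> _] := half_angle t.
have : 0 < cos (t / 2) by apply: cos_gt0_pihalf; apply/andP; split; lra.
by move=> c; rewrite addrC subrK mulr_gt0 ?exprn_gt0.
Qed.

Lemma angleK t : - pi < t < pi -> angle (cos t) (sin t) = t.
Proof.
move=> /andP[t1 t2]; rewrite /angle; have [-> ->] := half_angle t.
have c : 0 < cos (t / 2) by apply: cos_gt0_pihalf; apply/andP; split; lra.
have -> : 2 * cos (t / 2) * sin (t / 2) / (1 + (2 * cos (t / 2) ^+ 2 - 1)) =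
    tan (t / 2).
  rewrite /tan; field; rewrite gt_eqF//= [1 + _]addrC subrK.
  by rewrite mulf_neq0 ?expf_neq0 ?gt_eqF.
by rewrite tanK ?in_itv/=; [field|apply/andP; split; lra].
Qed.

Lemma polar x y : x ^+ 2 + y ^+ 2 = 1 ->
  exists2 t, - pi <= t <= pi & x = cos t /\ y = sin t.
Proof.
move=> xy1; have x1 : -1 <= x <= 1.
  by have : 0 <= y ^+ 2 by [exact: sqr_ge0]; move=> y0; apply/andP; split; nra.
have p0 := acos_ge0 x1; have p1 := acos_lepi x1.
have sE : sin (acos x) = `|y|.
  by rewrite sin_acos// -xy1 addrAC subrr add0r sqrtr_sqr.
have cE : cos (acos x) = x by rewrite acosK// in_itv.
have [y0|y0] := lerP 0 y.
  by exists (acos x); rewrite ?cE ?sE ?(ger0_norm y0)//; apply/andP; split; lra.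
exists (- acos x); first by apply/andP; split; lra.
by rewrite cosN sinN cE sE (ltr0_norm y0) opprK.
Qed.

Lemma polar_open x y : x ^+ 2 + y ^+ 2 = 1 -> 1 + x != 0 ->
  - pi < angle x y < pi /\ x = cos (angle x y) /\ y = sin (angle x y).
Proof.
move=> /polar[t /andP[t1 t2] [-> ->]] x1.
have tpi : t != pi by apply: contraNneq x1 => ->; rewrite cospi subrr.
have tNpi : t != - pi by apply: contraNneq x1 => ->; rewrite cosN cospi subrr.
have t12 : - pi < t < pi by rewrite !lt_neqAle t1 t2 tpi eq_sym tNpi.
by rewrite angleK.
Qed.

Lemma continuous_angle (T : topologicalType) (f g : T -> R) (z : T) :
  {for z, continuous f} -> {for z, continuous g} -> 1 + f z != 0 ->
  {for z, continuous (fun w => angle (f w) (g w))}.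
Proof.
move=> cf cg fz; apply: cvgM; first exact: cvg_cst.
apply: continuous_comp; last exact: continuous_atan.
apply: cvgM => //; apply: cvgV => //; apply: cvgD => //; exact: cvg_cst.
Qed.

End Angle.

(** * The circle as a compact connected space *)

Section Circle.
Variable R : realType.

Definition circle_set : set (R * R) := [set z | z.1 ^+ 2 + z.2 ^+ 2 = 1].

Definition circle : Type := set_type circle_set.

HB.instance Definition _ := PseudoMetric.copy circle (set_type circle_set).

Definition circle_val (z : circle) : R * R := set_val z.

Lemma circleP (z : circle) : (circle_val z).1 ^+ 2 + (circle_val z).2 ^+ 2 = 1.
Proof. by have := valP z; rewrite inE. Qed.

Definition cis_subproof (t : R) : (cos t, sin t) \in circle_set.
Proof. by rewrite inE /circle_set/= cos2Dsin2. Qed.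

Definition cis (t : R) : circle := exist _ (cos t, sin t) (cis_subproof t).

Lemma cisE t : circle_val (cis t) = (cos t, sin t).
Proof. by rewrite /circle_val set_valE. Qed.

HB.instance Definition _ := isPointed.Build circle (cis 0).

Lemma circle_valI : injective circle_val.
Proof. exact: val_inj. Qed.

Lemma continuous_circle_val : continuous circle_val.
Proof. exact: (@initial_continuous _ _ set_val). Qed.

(** The topology of the circle is the initial one for the inclusion in the
    plane. *)
Lemma continuous_to_circle (T : topologicalType) (f : T -> circle) (z : T) :
  {for z, continuous (circle_val \o f)} -> {for z, continuous f}.
Proof.
move=> cf U [?/= [[W oW <-]]] /= Wsfz /filterS; apply; apply: cf.
exact: open_nbhs_nbhs.
Qed.

Lemma continuous_cis : continuous cis.
Proof.
move=> t; apply: continuous_to_circle.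
exact: (cvg_pair (@continuous_cos R t) (@continuous_sin R t)).
Qed.

Lemma cis_surj (z : circle) : exists2 t, - pi <= t <= pi & cis t = z.
Proof.
have [t tpi [xt yt]] := polar (circleP z); exists t => //.
by apply: circle_valI; rewrite [RHS]surjective_pairing xt yt cisE.
Qed.

Lemma circle_hausdorff : hausdorff_space circle.
Proof.
move=> p q pq; apply: circle_valI.
apply: (@norm_hausdorff R (R * R)%type) => A B nA nB.
have [] := pq (circle_val @^-1` A) (circle_val @^-1` B).
- exact: continuous_circle_val.
- exact: continuous_circle_val.
by move=> z [Az Bz]; exists (circle_val z).
Qed.

Lemma circle_compact : compact [set: circle].
Proof.
have -> : [set: circle] = cis @` `[- pi, pi].
  apply/seteqP; split=> // z _; have [t tpi <-] := cis_surj z.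
  by exists t => //=; rewrite in_itv.
apply: continuous_compact; last exact: segment_compact.
by apply: continuous_subspaceT => t; exact: continuous_cis.
Qed.

Lemma circle_connected : connected [set: circle].
Proof.
have -> : [set: circle] = cis @` [set: R].
  by apply/seteqP; split=> // z _; have [t _ <-] := cis_surj z; exists t.
apply: connected_continuous_connected.
  exact/connected_intervalP.
by apply: continuous_subspaceT => t; exact: continuous_cis.
Qed.

Lemma circle_second_countable : @second_countable circle.
Proof. exact: (compact_second_countable circle_compact). Qed.

End Circle.

(** * The smooth structure of the circle *)

(** The changes of charts of the circle are not translations: they are only
    locally so, as the two arcs where both charts are defined are shifted in
    opposite ways. *)

Lemma smooth_locally_translation (R : realType) (d : nat) (V : set 'rV[R]_d)
    (F : 'rV[R]_d -> 'rV[R]_d) :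
  open V -> (forall y, V y -> exists c, {near y, (fun z => z + c) =1 F}) ->
  smooth_on V F.
Proof.
move=> oV locF k.
have cF y : V y -> {for y, continuous F}.
  move=> /locF[c zF]; rewrite /prop_for /continuous_at -(nbhs_singleton zF).
  by apply: cvg_trans (near_eq_cvg zF) _; apply: cvgD => //; exact: cvg_cst.
have dF y l : V y -> is_derive y (delta_mx 0 l) F (delta_mx 0 l).
  move=> /locF[c zF]; apply: near_eq_is_derive zF _.
  by apply: is_derive_eq; exact: addr0.
case: k => [|k]; split=> // l; split=> [y Vy|]; first by case: (dF y l Vy).
apply: class_C_eq oV _ (class_C_cst k V (delta_mx 0 l : 'rV[R]_d)) => y Vy.
by case: (dF y l Vy).
Qed.

Section CircleManifold.
Variable R : realType.
Implicit Types (b : bool) (z : circle R) (t : R).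

(** The angle of (-1)^b z: the chart of index b omits the point of abscissa
    - (-1)^b, and the coordinate t stands for the point of angle t + b pi. *)
Definition circle_angle b z : R :=
  angle ((-1) ^+ b * (circle_val z).1) ((-1) ^+ b * (circle_val z).2).

Definition circle_dom b : set (circle R) :=
  [set z | 1 + (-1) ^+ b * (circle_val z).1 != 0].

Definition circle_chart b z : 'rV[R]_1 := const_mx (circle_angle b z).

Definition circle_chart_inv b (v : 'rV[R]_1) : circle R :=
  cis (v 0 0 + pi *+ b).

Lemma cisD_eq t t' c : cis t = cis t' -> cis (t + c) = cis (t' + c).
Proof.
move=> /(congr1 (@circle_val R)); rewrite !cisE => -[ct st].
by apply: circle_valI; rewrite !cisE !cosD !sinD ct st.
Qed.

Lemma circle_val_cisDpi t b :
  circle_val (cis (t + pi *+ b)) = ((-1) ^+ b * cos t, (-1) ^+ b * sin t).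
Proof.
by case: b; rewrite cisE ?addr0 ?mul1r// mulr1n cosDpi sinDpi !mulN1r.
Qed.

Lemma circle_angleK b t : - pi < t < pi -> circle_angle b (cis (t + pi *+ b)) = t.
Proof.
by move=> tpi; rewrite /circle_angle circle_val_cisDpi/= !signrMK angleK.
Qed.

Lemma circle_dom_cis b t : - pi < t < pi -> circle_dom b (cis (t + pi *+ b)).
Proof.
move=> tpi; rewrite /circle_dom /mkset circle_val_cisDpi/= signrMK.
by rewrite gt_eqF// onePcos_gt0.
Qed.

Lemma circle_angle_itv b z : - pi < circle_angle b z < pi.
Proof. by rewrite angle_gtNpi angle_ltpi. Qed.

Lemma cis_circle_angle b z : circle_dom b z ->
  cis (circle_angle b z + pi *+ b) = z.
Proof.
move=> zb; apply: circle_valI; rewrite circle_val_cisDpi.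
have sz1 : ((-1) ^+ b * (circle_val z).1) ^+ 2 +
    ((-1) ^+ b * (circle_val z).2) ^+ 2 = 1.
  by rewrite !exprMn sqrr_sign !mul1r circleP.
have [_ [<- <-]] := polar_open sz1 zb.
by rewrite !signrMK -surjective_pairing.
Qed.

(** Each chart inverts the covering map cis up to a translation, near every
    lift t of a point of its domain.  All the local computations on the circle
    go through this. *)
Lemma near_circle_angle b t : circle_dom b (cis t) ->
  \forall u \near t, circle_angle b (cis u) = circle_angle b (cis t) + (u - t).
Proof.
move=> tb; have /andP[l1 l2] := circle_angle_itv b (cis t).
set p := circle_angle b (cis t) in l1 l2 *.
have cu : {for t, continuous (fun u => p + (u - t))}.
  by apply: cvgD; [exact: cvg_cst|apply: cvgB => //; exact: cvg_cst].
have l1' : - pi < p + (t - t) by rewrite subrr addr0.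
have l2' : p + (t - t) < pi by rewrite subrr addr0.
near=> u.
have -> : cis u = cis (p + (u - t) + pi *+ b).
  rewrite addrAC; have := cisD_eq (u - t) (cis_circle_angle tb).
  by rewrite -/p [t + _]addrC subrK => ->.
rewrite circle_angleK//; apply/andP; split; near: u.
  exact: (cvgr_gt _ cu).
exact: (cvgr_lt _ cu).
Unshelve. all: by end_near. Qed.

Lemma continuous_scaled (T : topologicalType) (f : T -> R) (c : R) (x : T) :
  {for x, continuous f} -> {for x, continuous (fun w => c * f w)}.
Proof. by move=> cf; apply: cvgM => //; exact: cvg_cst. Qed.

Lemma continuous_shifted (T : topologicalType) (f : T -> R) (c : R) (x : T) :
  {for x, continuous f} -> {for x, continuous (fun w => f w + c)}.
Proof. by move=> cf; apply: cvgD => //; exact: cvg_cst. Qed.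

Lemma continuous_circle_val1 : continuous (fun z => (circle_val z).1).
Proof.
move=> z; apply: (@continuous_comp _ _ _ (@circle_val R) fst).
  exact: continuous_circle_val.
exact: cvg_fst.
Qed.

Lemma continuous_circle_val2 : continuous (fun z => (circle_val z).2).
Proof.
move=> z; apply: (@continuous_comp _ _ _ (@circle_val R) snd).
  exact: continuous_circle_val.
exact: cvg_snd.
Qed.

Lemma circle_dom_open b : open (circle_dom b).
Proof.
have cf z : {for z, continuous (fun z => (-1) ^+ b * (circle_val z).1)}.
  by apply: continuous_scaled; exact: continuous_circle_val1.
have -> : circle_dom b =
    (fun z => (-1) ^+ b * (circle_val z).1) @^-1` [set x | x != -1].
  by apply/seteqP; split=> z; rewrite /circle_dom /= addrC addr_eq0.
by apply: open_comp; [move=> z _; exact: cf|exact: open_neq].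
Qed.

Lemma continuous_circle_angle b z : circle_dom b z ->
  {for z, continuous (circle_angle b)}.
Proof.
move=> zb; apply: continuous_angle => //; apply: continuous_scaled.
  exact: continuous_circle_val1.
exact: continuous_circle_val2.
Qed.

Lemma continuous_circle_chart b z : circle_dom b z ->
  {for z, continuous (circle_chart b)}.
Proof.
move=> /continuous_circle_angle cz A [P nP PA].
have nP0 : nbhs (circle_angle b z) (P 0 0) by have := nP 0 0; rewrite mxE.
have nw : \forall w \near z, P 0 0 (circle_angle b w) by exact: cz nP0.
have : \forall w \near z, A (circle_chart b w).
  by apply: filterS nw => w Pw; apply: PA => k l; rewrite !ord1 mxE.
by [].
Qed.

Lemma continuous_coordD (c : R) (y : 'rV[R]_1) :
  {for y, continuous (fun v : 'rV[R]_1 => v 0 0 + c)}.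
Proof. by have := @continuous_shifted 'rV[R]_1 (fun v => v 0 0) c y (@continuous_coord R y). Qed.

Lemma continuous_circle_chart_inv b : continuous (circle_chart_inv b).
Proof.
move=> v; apply: (@continuous_comp _ _ _ (fun v : 'rV[R]_1 => v 0 0 + pi *+ b) (@cis R)).
  exact: continuous_coordD.
exact: continuous_cis.
Qed.

Lemma rV1P (v w : 'rV[R]_1) : v 0 0 = w 0 0 -> v = w.
Proof. by move=> vw; apply/rowP => l; rewrite ord1. Qed.

Lemma circle_chartK b z : circle_dom b z ->
  circle_chart_inv b (circle_chart b z) = z.
Proof. by move=> zb; rewrite /circle_chart_inv mxE cis_circle_angle. Qed.

Lemma circle_chart_image b (A : set (circle R)) :
  circle_chart b @` (circle_dom b `&` A) =
  [set v : 'rV[R]_1 | - pi < v 0 0 < pi] `&` circle_chart_inv b @^-1` A.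
Proof.
apply/seteqP; split=> [_ [z [zb Az] <-]|v [vpi Av]].
  by rewrite /= circle_chartK// mxE; split=> //; exact: circle_angle_itv.
exists (circle_chart_inv b v); first by split=> //; exact: circle_dom_cis.
by apply: rV1P; rewrite mxE circle_angleK.
Qed.

Lemma open_circle_chart_image b (A : set (circle R)) :
  open A -> open (circle_chart b @` (circle_dom b `&` A)).
Proof.
move=> oA; rewrite circle_chart_image; apply: openI; last first.
  by apply: open_comp oA => v _; exact: continuous_circle_chart_inv.
have -> : [set v : 'rV[R]_1 | - pi < v 0 0 < pi] =
    (fun v : 'rV[R]_1 => v 0 0) @^-1` `]- pi, pi[.
  by apply/seteqP; split=> v /=; rewrite in_itv.
by apply: open_comp (itv_open _ _) => v _; exact: continuous_coord.
Qed.

Lemma circle_transition i j (y : 'rV[R]_1) :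
  (circle_chart i @` (circle_dom i `&` circle_dom j)) y ->
  exists c, {near y, (fun v => v + c) =1 circle_chart j \o circle_chart_inv i}.
Proof.
rewrite circle_chart_image => -[_ /= yj].
set t := y 0 0 + pi *+ i.
exists (const_mx (circle_angle j (cis t) - y 0 0)).
have ct : {for y, continuous (fun v : 'rV[R]_1 => v 0 0 + pi *+ i)}.
  exact: continuous_coordD.
have ny : \forall v \near y, circle_angle j (cis ((v : 'rV[R]_1) 0 0 + pi *+ i)) =
    circle_angle j (cis t) + (v 0 0 + pi *+ i - t).
  exact: (ct _ (near_circle_angle yj)).
apply: filterS ny => v vE.
by apply: rV1P; rewrite !mxE vE /t; ring.
Qed.

Definition circle_manifold : smoothManifold R.
Proof.
apply: (@SmoothManifold R (circle R) 1 isT (@circle_hausdorff R)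
  (@circle_second_countable R) bool circle_dom circle_chart circle_chart_inv).
- exact: circle_dom_open.
- by move=> b; rewrite -[circle_dom b]setIT; apply: open_circle_chart_image; exact: openT.
- exact: circle_chartK.
- exact: continuous_circle_chart.
- by move=> b y _; exact: continuous_circle_chart_inv.
- move=> z; have [z1|] := eqVneq (1 + (circle_val z).1) 0.
    exists true; rewrite /circle_dom/= mulN1r.
    by apply/eqP => z2; move: z1 z2 => /eqP; lra.
  by move=> z1; exists false; rewrite /circle_dom/= mul1r.
- move=> i j; apply: smooth_locally_translation.
    by apply: open_circle_chart_image; exact: circle_dom_open.
  exact: circle_transition.
Defined.

End CircleManifold.

(** * The round metric and its geodesic flow *)

Lemma jacobian_translation (R : realType) (d : nat) (F : 'rV[R]_d -> 'rV[R]_d)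
    (y c : 'rV[R]_d) :
  {near y, (fun z => z + c) =1 F} -> 'J F y = 1%:M.
Proof.
move=> zF.
have dF : 'd F y = idfun :> ('rV[R]_d -> 'rV[R]_d).
  apply: diff_unique; first by move=> v; exact: cvg_id.
  apply/eqaddoP => _ /posnumP[e].
  have nF : \forall h \near (0 : 'rV[R]_d), (h : 'rV[R]_d) + y + c = F (h + y).
    by have := zF; rewrite (near_shift 0) /=; apply: filterS => h /=; rewrite subr0.
  apply: filterS nF => h hE; rewrite /= !fctE /= -hE -(nbhs_singleton zF).
  by rewrite -[h + y + c]addrA [h + _]addrC subrr normr0 mulr_ge0.
by apply/row_matrixP => k; rewrite !rowE mul_rV_lin1 dF mulmx1.
Qed.

Section RoundCircle.
Variable R : realType.

Let M0 := circle_manifold R.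

Lemma circle_jacobian (i j : bool) (z : circle R) :
  circle_dom i z -> circle_dom j z ->
  @transition_jacobian R M0 i j z = 1%:M.
Proof.
move=> zi zj; rewrite /transition_jacobian /=.
have [c zF] : exists c, {near circle_chart i z,
    (fun v => v + c) =1 circle_chart j \o circle_chart_inv i}.
  by apply: circle_transition; exists z.
exact: jacobian_translation zF.
Qed.

(** The Gram matrix is 1 in both charts, which is consistent because the
    transitions have Jacobian 1. *)
Definition round_circle : closedRiemannianManifold R.
Proof.
apply: (@ClosedRiemannianManifold R M0 _ _ _ (fun _ _ => 1%:M)).
- by exists (cis 0).
- exact: circle_compact.
- exact: circle_connected.
- by move=> i k; exact: class_C_cst.
- by move=> i y _; rewrite trmx1.
- move=> i y _ v v0; rewrite mulmx1 mxE big_ord1 mxE -expr2 exprn_even_gt0//=.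
  by apply: contraNneq v0 => v00; apply/eqP/rV1P; rewrite v00 mxE.
- by move=> i j z zi zj; rewrite circle_jacobian// trmx1 !mulmx1.
Defined.

Lemma hamiltonianE (i : bool) (y p : 'rV[R]_1) :
  @hamiltonian R round_circle i y p = (p 0 0) ^+ 2.
Proof. by rewrite /hamiltonian /= invmx1 mulmx1 mxE big_ord1 mxE expr2. Qed.

Lemma derive_hamiltonian_momentum (i : bool) (y p : 'rV[R]_1) :
  (\row_k 'D_(delta_mx 0 k) (fun q => @hamiltonian R round_circle i y q) p)
  = 2 *: p.
Proof.
apply: rV1P; rewrite !mxE.
have -> : (fun q => @hamiltonian R round_circle i y q) =
    (fun q : 'rV[R]_1 => (fun x : R => x ^+ 2) (q 0 0)).
  by apply/funext => q; rewrite hamiltonianE.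
rewrite (derive_coord (fun x : R => x ^+ 2)) exp_derive.
by rewrite expr1 /GRing.scale/=; ring.
Qed.

Lemma derive_hamiltonian_position (i : bool) (y p : 'rV[R]_1) :
  (\row_k 'D_(delta_mx 0 k) (fun z => @hamiltonian R round_circle i z p) y)
  = 0.
Proof.
apply: rV1P; rewrite !mxE.
have -> : (fun z => @hamiltonian R round_circle i z p) = cst ((p 0 0) ^+ 2).
  by apply/funext => q; rewrite hamiltonianE.
by rewrite derive_cst.
Qed.

End RoundCircle.

Section RealDerivatives.
Variable R : realType.
Implicit Types (f g : R -> R) (t a b : R).

Lemma is_derive_add f g t a b : is_derive t 1 f a -> is_derive t 1 g b ->
  is_derive t 1 (fun s => f s + g s) (a + b).
Proof. exact: is_deriveD. Qed.

Lemma is_derive_sub f g t a b : is_derive t 1 f a -> is_derive t 1 g b ->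
  is_derive t 1 (fun s => f s - g s) (a - b).
Proof. exact: is_deriveB. Qed.

Lemma is_derive_mul f g t a b : is_derive t 1 f a -> is_derive t 1 g b ->
  is_derive t 1 (fun s => f s * g s) (a * g t + f t * b).
Proof.
move=> fa gb; apply: (is_derive_eq (is_deriveM fa gb)).
by rewrite /GRing.scale/= addrC [g t * a]mulrC.
Qed.

Lemma is_derive_affine a b t : is_derive t 1 (fun s => a + b * s) b.
Proof.
apply: (is_derive_eq (is_derive_add (is_derive_cst a t 1)
  (is_derive_mul (is_derive_cst b t 1) (is_derive_id t 1)))).
by rewrite mul0r mulr1 !add0r.
Qed.

Lemma is_derive_cos_comp f t a : is_derive t 1 f a ->
  is_derive t 1 (fun s => cos (f s)) (- sin (f t) * a).
Proof. by move=> fa; exact: is_derive1_comp. Qed.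

Lemma is_derive_sin_comp f t a : is_derive t 1 f a ->
  is_derive t 1 (fun s => sin (f s)) (cos (f t) * a).
Proof. by move=> fa; exact: is_derive1_comp. Qed.

Lemma is_derive_const_mx f t a : is_derive t 1 f a ->
  is_derive t 1 (fun s => const_mx (f s) : 'rV[R]_1) (const_mx a).
Proof.
move=> [df fa]; have fE i j : (fun s => (const_mx (f s) : 'rV[R]_1) i j) = f.
  by apply/funext => s; rewrite mxE.
have dF : derivable (fun s => const_mx (f s) : 'rV[R]_1) t 1.
  by apply/derivable_mxP => i j; rewrite fE.
by apply: DeriveDef => //; rewrite derive_mx//; apply/matrixP => i j; rewrite !mxE fE.
Qed.

Lemma is_derive_entry (F : R -> 'rV[R]_1) t D : is_derive t 1 F D ->
  is_derive t 1 (fun s => F s 0 0) (D 0 0).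
Proof.
move=> [dF <-]; apply: DeriveDef.
  exact: (iffLR (derivable_mxP F t 1) dF 0 0).
by rewrite derive_mx// mxE.
Qed.

End RealDerivatives.

Section GeodesicFlow.
Variable R : realType.
Let M := round_circle R.
Implicit Types (z : circle R) (c t : R) (b : bool).

(** In dimension one, with transitions of Jacobian 1, a covector is a number c:
    it has the component c in all the charts around its base point. *)
Definition covector z c : covector_family M :=
  (z, fun b => if 1 + (-1) ^+ b * (circle_val z).1 != 0 then const_mx c else 0).

Lemma covector_in_dom z c b : circle_dom b z -> (covector z c).2 b = const_mx c.
Proof. by rewrite /circle_dom/= => ->. Qed.

Lemma cotangent_covector z c : @cotangent_bundle R M (covector z c).
Proof.
split=> [i j zi zj|i /negP/negbTE /= -> //].
by rewrite circle_jacobian// trmx1 mulmx1 !covector_in_dom.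
Qed.

Lemma circle_dom_cover z : exists b, circle_dom b z.
Proof. exact: (@chart_cover R M z). Qed.

Lemma cotangentP (rho : covector_family M) : @cotangent_bundle R M rho ->
  exists c, rho = covector rho.1 c.
Proof.
move=> [rhoJ rho0]; have [i zi] := circle_dom_cover rho.1.
exists (rho.2 i 0 0); rewrite [LHS]surjective_pairing; congr pair.
apply/funext => j; case: ifPn => [zj|/negP/rho0//].
rewrite (rhoJ j i)// circle_jacobian// trmx1 mulmx1.
by apply: rV1P; rewrite mxE.
Qed.

Lemma cosphere_covector z c :
  @cosphere_bundle R M (covector z c) <-> `|c| = 2^-1.
Proof.
have [i zi] := circle_dom_cover z.
split=> [[_ /(_ i zi)]|c2].
  by rewrite hamiltonianE covector_in_dom// mxE sqrtr_sqr.
split=> [|j zj]; first exact: cotangent_covector.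
by rewrite hamiltonianE covector_in_dom// mxE sqrtr_sqr.
Qed.

Lemma near_covector (T : topologicalType) (f : T -> circle R) (x : T) b :
  {for x, continuous f} -> circle_dom b (f x) ->
  \forall y \near x, circle_dom b (f y).
Proof.
move=> cf fxb; apply: cf; apply: open_nbhs_nbhs; split=> //.
exact: circle_dom_open.
Qed.

Lemma hamiltonian_curve_circle (theta c : R) :
  @hamiltonian_curve R M (fun t => covector (cis (theta + 2 * c * t)) c).
Proof.
have daff t : is_derive t 1 (fun s => theta + 2 * c * s) (2 * c).
  exact: is_derive_affine.
have caff t : {for t, continuous (fun s : R => theta + 2 * c * s)}.
  by apply: differentiable_continuous; apply/derivable1_diffP; case: (daff t).
have ccis : continuous (fun t : R => cis (theta + 2 * c * t)).
  move=> t; apply: (@continuous_comp _ _ _ (fun s : R => theta + 2 * c * s)) => //.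
  exact: continuous_cis.
split=> [t||t i ti]; [exact: cotangent_covector|exact: ccis|split].
- rewrite [X in is_derive _ _ _ X]derive_hamiltonian_momentum covector_in_dom//.
  have -> : 2 *: const_mx c = const_mx (2 * c) :> 'rV[R]_1.
    by apply: rV1P; rewrite !mxE.
  have nt : \forall s \near t, circle_angle i (cis (theta + 2 * c * s)) =
      circle_angle i (cis (theta + 2 * c * t)) +
        (theta + 2 * c * s - (theta + 2 * c * t)).
    exact: (caff t _ (near_circle_angle ti)).
  have nt' : \forall s \near t, const_mx (circle_angle i (cis (theta + 2 * c * t))
      - 2 * c * t + 2 * c * s) = circle_chart i (cis (theta + 2 * c * s)).
    apply: filterS nt => s sE; rewrite /circle_chart sE; congr const_mx; ring.
  apply: near_eq_is_derive nt' _; apply: is_derive_const_mx.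
  exact: is_derive_affine.
- rewrite [X in is_derive _ _ _ (- X)]derive_hamiltonian_position oppr0.
  apply: (@near_eq_is_derive _ _ _ (cst (const_mx c))).
  apply: filterS (near_covector (ccis t) ti) => s si.
  by rewrite covector_in_dom.
Qed.

(** The component of the covector is locally the same in all charts and its
    derivative is 0, as the Hamiltonian does not depend on the position. *)
Lemma hamiltonian_curve_momentum (gamma : R -> covector_family M) :
  @hamiltonian_curve R M gamma ->
  exists c, forall t, gamma t = covector (gamma t).1 c.
Proof.
move=> [cot cont Dg].
have /choice[c cE] : forall t, exists c, gamma t = covector (gamma t).1 c.
  by move=> t; exact: cotangentP.
suff c0 t : is_derive t 1 c 0.
  by exists (c 0) => t; rewrite (is_derive_0_is_cst 0 t c0).
have [i ti] := circle_dom_cover (gamma t).1.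
have [_ Dp] := Dg t i ti.
move: Dp; rewrite [X in is_derive _ _ _ (- X)]derive_hamiltonian_position oppr0.
move=> /is_derive_entry; rewrite mxE; apply: near_eq_is_derive.
apply: filterS (near_covector (cont t) ti) => s si.
by rewrite cE covector_in_dom// mxE.
Qed.

(** The chart angle has derivative 2 c, so the planar coordinates (X, Y) of the
    curve solve the global linear system X' = - 2 c Y, Y' = 2 c X, which is
    integrated without reference to the charts. *)
Lemma hamiltonian_curve_unique (gamma : R -> covector_family M) theta c :
  @hamiltonian_curve R M gamma -> gamma 0 = covector (cis theta) c ->
  forall t, gamma t = covector (cis (theta + 2 * c * t)) c.
Proof.
move=> Hg g0; have [c' gE] := hamiltonian_curve_momentum Hg.
have c'E : c' = c.
  have [i i0] := circle_dom_cover (cis theta).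
  have := congr1 (fun rho : covector_family M => rho.2 i 0 0) (gE 0).
  by rewrite {1}g0 !covector_in_dom ?g0//= !mxE.
rewrite {c'}c'E in gE.
have [cot cont Dg] := Hg.
pose X t := (circle_val (gamma t).1).1; pose Y t := (circle_val (gamma t).1).2.
have [dX dY] : (forall t, is_derive t 1 X (- Y t * (2 * c))) /\
               (forall t, is_derive t 1 Y (X t * (2 * c))).
  apply/all_and2 => t.
  have [i ti] := circle_dom_cover (gamma t).1.
  have [Dq _] := Dg t i ti.
  pose phi s := circle_angle i (gamma s).1.
  have dphi : is_derive t 1 phi (2 * c).
    move: Dq; rewrite [X in is_derive _ _ _ X]derive_hamiltonian_momentum.
    rewrite gE covector_in_dom// => /is_derive_entry; rewrite !mxE.
    suff -> : phi = (fun s => circle_chart i (gamma s).1 0 0) by [].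
    by apply/funext => s; rewrite mxE.
  have XYs : \forall s \near t, (gamma s).1 = cis (phi s + pi *+ i).
    apply: filterS (near_covector (cont t) ti) => s si.
    by rewrite cis_circle_angle.
  have dphi' : is_derive t 1 (fun s => phi s + pi *+ i) (2 * c).
    by apply: is_derive_eq (is_derive_add dphi (is_derive_cst _ t 1)) _; rewrite addr0.
  have tE := nbhs_singleton XYs.
  split.
    have -> : Y t = sin (phi t + pi *+ i) by rewrite /Y tE cisE.
    apply: near_eq_is_derive (is_derive_cos_comp dphi').
    by apply: filterS XYs => s sE; rewrite /X sE cisE.
  have -> : X t = cos (phi t + pi *+ i) by rewrite /X tE cisE.
  apply: near_eq_is_derive (is_derive_sin_comp dphi').
  by apply: filterS XYs => s sE; rewrite /Y sE cisE.
(* The curve seen from the frame that rotates at its speed does not move; 0 +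
   puts the angle in the form of is_derive_affine. *)
have daff t : is_derive t 1 (fun s => 0 + 2 * c * s) (2 * c).
  exact: is_derive_affine.
pose P t := X t * cos (0 + 2 * c * t) + Y t * sin (0 + 2 * c * t).
pose Q t := Y t * cos (0 + 2 * c * t) - X t * sin (0 + 2 * c * t).
have dP t : is_derive t 1 P 0.
  apply: is_derive_eq (is_derive_add
    (is_derive_mul (dX t) (is_derive_cos_comp (daff t)))
    (is_derive_mul (dY t) (is_derive_sin_comp (daff t)))) _.
  by ring.
have dQ t : is_derive t 1 Q 0.
  apply: is_derive_eq (is_derive_sub
    (is_derive_mul (dY t) (is_derive_cos_comp (daff t)))
    (is_derive_mul (dX t) (is_derive_sin_comp (daff t)))) _.
  by ring.
have P0 t : P t = cos theta.
  rewrite (is_derive_0_is_cst t 0 dP) /P /X /Y g0 cisE.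
  by rewrite mulr0 addr0 cos0 sin0 mulr1 mulr0 addr0.
have Q0 t : Q t = sin theta.
  rewrite (is_derive_0_is_cst t 0 dQ) /Q /X /Y g0 cisE.
  by rewrite mulr0 addr0 cos0 sin0 mulr1 mulr0 subr0.
move=> t; rewrite gE; congr covector.
have cs := cos2Dsin2 (0 + 2 * c * t).
apply: circle_valI; rewrite [LHS]surjective_pairing cisE cosD sinD -(P0 t) -(Q0 t).
rewrite -/(X t) -/(Y t) -[2 * c * t]add0r /P /Q.
set C := cos _ in cs *; set S := sin _ in cs *.
congr pair.
  by rewrite -[LHS]mulr1 -cs; ring.
by rewrite -[LHS]mulr1 -cs; ring.
Qed.

Lemma geodesic_flow_circle (theta c t : R) :
  @geodesic_flow R M t (covector (cis theta) c) =
  covector (cis (theta + 2 * c * t)) c.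
Proof.
rewrite /geodesic_flow; case: xgetP => [gamma _ [Hg g0]|none].
  exact: hamiltonian_curve_unique.
have := none (fun t => covector (cis (theta + 2 * c * t)) c); case.
split; first exact: hamiltonian_curve_circle.
by rewrite mulr0 addr0.
Qed.

End GeodesicFlow.

(** * The decay rate from exponential bounds *)

Section GrowthRate.
Variables (R : realType) (M : closedRiemannianManifold R) (n : nat).

(** The factors m and m' disappear in the limit because their logarithms are
    divided by t; it matters that they do not depend on rho. *)
Lemma C_infty_exponential (a : M -> 'M[R[i]]_n) (r m m' : R) :
  0 < m -> (exists rho, @cosphere_bundle R M rho) ->
  (forall t rho, 0 < t -> @cosphere_bundle R M rho ->
     m * expR (- (r * t)) <= opnorm2 (Gplus a t rho) <= m' * expR (- (r * t))) ->
  C_infty a = r.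
Proof.
move=> m0 [rho0 Srho0] bnd.
have m'0 : 0 < m'.
  have /andP[b1 b2] := bnd 1 rho0 ltr01 Srho0.
  rewrite -(pmulr_lgt0 _ (expR_gt0 (- (r * 1)))).
  by apply: lt_le_trans (le_trans b1 b2); rewrite mulr_gt0 ?expR_gt0.
pose S t := [set ln (opnorm2 (Gplus a t rho)) | rho in @cosphere_bundle R M].
have lnE k t : 0 < k -> ln (k * expR (- (r * t))) = ln k - r * t.
  by move=> k0; rewrite lnM ?posrE ?expR_gt0// expRK.
have Sb t : 0 < t -> forall x, S t x -> ln m - r * t <= x <= ln m' - r * t.
  move=> t0 _ [rho Srho <-]; have /andP[b1 b2] := bnd t rho t0 Srho.
  have p1 : 0 < m * expR (- (r * t)) by rewrite mulr_gt0 ?expR_gt0.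
  have p2 := lt_le_trans p1 b1.
  rewrite -!lnE// !ler_ln ?posrE ?b1 ?b2//.
  by rewrite mulr_gt0 ?expR_gt0.
have Ssup t : 0 < t -> ln m - r * t <= sup (S t) <= ln m' - r * t.
  move=> t0; have S0 : S t (ln (opnorm2 (Gplus a t rho0))) by exists rho0.
  apply/andP; split.
    have /andP[le1 _] := Sb t t0 _ S0; apply: le_trans le1 _.
    by apply: ub_le_sup => //; exists (ln m' - r * t) => x /(Sb t t0)/andP[].
  by apply: ge_sup; [exists (ln (opnorm2 (Gplus a t rho0)))|move=> x /(Sb t t0)/andP[]].
have cvgr (k : R) : (r - k * t^-1) @[t --> +oo] --> r.
  rewrite -[X in _ --> X]subr0; apply: cvgB; first exact: cvg_cst.
  rewrite -[X in _ --> X](mulr0 k); apply: cvgM; first exact: cvg_cst.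
  by apply/(@gtr0_cvgV0 _ _ _ _ id); [exact: nbhs_pinfty_gt|exact: cvg_id].
rewrite /C_infty; apply: cvg_lim; first exact: Rhausdorff.
apply: squeeze_cvgr (cvgr (ln m')) (cvgr (ln m)).
near=> t; have t0 : 0 < t by near: t; exact: nbhs_pinfty_gt.
have /andP[s1 s2] := Ssup t t0.
rewrite -/(S t) !mulN1r mulNr; apply/andP; split.
  rewrite lerNr opprB -(ler_pM2l t0) mulrA divff ?gt_eqF// mul1r.
  apply: le_trans s2 _; rewrite le_eqVlt; apply/orP; left; apply/eqP.
  by field; rewrite gt_eqF.
rewrite lerNl opprB -(ler_pM2l t0) [leRHS]mulrA divff ?gt_eqF// mul1r.
apply: le_trans _ s1; rewrite le_eqVlt; apply/orP; left; apply/eqP.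
by field; rewrite gt_eqF.
Unshelve. all: by end_near. Qed.

End GrowthRate.

(** * A submultiplicative norm on complex matrices *)

Section ComplexMatrixNorm.
Variable R : realType.
Implicit Types z w : R[i].

Lemma ReD z w : complex.Re (z + w) = complex.Re z + complex.Re w.
Proof. by case: z w => [a b] [c d]. Qed.

Lemma ImD z w : complex.Im (z + w) = complex.Im z + complex.Im w.
Proof. by case: z w => [a b] [c d]. Qed.

Lemma ReM z w : complex.Re (z * w) =
  complex.Re z * complex.Re w - complex.Im z * complex.Im w.
Proof. by case: z w => [a b] [c d]. Qed.

Lemma ImM z w : complex.Im (z * w) =
  complex.Re z * complex.Im w + complex.Im z * complex.Re w.
Proof. by case: z w => [a b] [c d]. Qed.

(** Submultiplicative like the modulus, but free of square roots. *)
Definition cnorm1 z : R := `|complex.Re z| + `|complex.Im z|.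

Lemma cnorm1_ge0 z : 0 <= cnorm1 z.
Proof. exact: addr_ge0. Qed.

Lemma cnorm1D z w : cnorm1 (z + w) <= cnorm1 z + cnorm1 w.
Proof. by rewrite /cnorm1 ReD ImD addrACA lerD// ler_normD. Qed.

Lemma cnorm1M z w : cnorm1 (z * w) <= cnorm1 z * cnorm1 w.
Proof.
rewrite /cnorm1 ReM ImM; set a := complex.Re z; set b := complex.Im z.
set c := complex.Re w; set d := complex.Im w.
rewrite (_ : (_ + _) * _ = (`|a * c| + `|b * d|) + (`|a * d| + `|b * c|)).
  by rewrite lerD// ?ler_normB ?ler_normD.
by rewrite !normrM; ring.
Qed.

Lemma cnorm1_sum (I : finType) (f : I -> R[i]) :
  cnorm1 (\sum_k f k) <= \sum_k cnorm1 (f k).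
Proof.
elim/big_ind2: _ => [|z x w y zx wy|//]; first by rewrite /cnorm1 !normr0 addr0.
exact: le_trans (cnorm1D _ _) (lerD zx wy).
Qed.

Definition mxnorm1 p q (A : 'M[R[i]]_(p, q)) : R := \sum_k \sum_l cnorm1 (A k l).

Lemma mxnorm1_ge0 p q (A : 'M[R[i]]_(p, q)) : 0 <= mxnorm1 A.
Proof. by do 2!apply: sumr_ge0 => ? _; exact: cnorm1_ge0. Qed.

Lemma mxnorm1_entry p q (A : 'M[R[i]]_(p, q)) k l : cnorm1 (A k l) <= mxnorm1 A.
Proof.
rewrite /mxnorm1 (bigD1 k)//= (bigD1 l)//= -addrA lerDl addr_ge0//.
  by apply: sumr_ge0 => ? _; exact: cnorm1_ge0.
by do 2!apply: sumr_ge0 => ? _; exact: cnorm1_ge0.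
Qed.

Lemma mxnorm1M p q s (A : 'M[R[i]]_(p, q)) (B : 'M[R[i]]_(q, s)) :
  mxnorm1 (A *m B) <= mxnorm1 A * mxnorm1 B.
Proof.
rewrite /mxnorm1 mulr_suml; apply: ler_sum => k _.
rewrite mulr_suml; under eq_bigr do rewrite mxE.
apply: (@le_trans _ _ (\sum_l \sum_j cnorm1 (A k j) * cnorm1 (B j l))).
  apply: ler_sum => l _; apply: le_trans (cnorm1_sum _) _.
  by apply: ler_sum => j _; exact: cnorm1M.
rewrite exchange_big /=; apply: ler_sum => j _; rewrite -mulr_sumr.
apply: ler_wpM2l; first exact: cnorm1_ge0.
rewrite [leRHS](bigD1 j)//= lerDl.
by do 2!apply: sumr_ge0 => ? _; exact: cnorm1_ge0.
Qed.

Lemma enorm_le_mxnorm1 n (v : 'cV[R[i]]_n) : enorm v <= mxnorm1 v.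
Proof.
have v0 := mxnorm1_ge0 v.
rewrite -[leRHS](ger0_norm v0) -sqrtr_sqr ler_wsqrtr//.
have -> : mxnorm1 v = \sum_k cnorm1 (v k 0).
  by apply: eq_bigr => k _; rewrite big_ord1.
suff H (s : seq 'I_n) :
  \sum_(k <- s) (complex.Re (v k 0) ^+ 2 + complex.Im (v k 0) ^+ 2) <=
  (\sum_(k <- s) cnorm1 (v k 0)) ^+ 2 by exact: H.
elim: s => [|k s IH]; first by rewrite !big_nil expr0n.
rewrite !big_cons sqrrD; have s0 : 0 <= \sum_(j <- s) cnorm1 (v j 0).
  by apply: sumr_ge0 => ? _; exact: cnorm1_ge0.
have k0 := cnorm1_ge0 (v k 0); apply: lerD => //.
apply: (@le_trans _ _ (cnorm1 (v k 0) ^+ 2)); last first.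
  by rewrite lerDl mulrn_wge0// mulr_ge0.
rewrite -(real_normK (num_real (complex.Re _))) -(real_normK (num_real (complex.Im _))).
rewrite /cnorm1 sqrrD addrAC lerDl mulrn_wge0// mulr_ge0.
Qed.

Lemma cnorm1_le_enorm n (v : 'cV[R[i]]_n) k : cnorm1 (v k 0) <= 2 * enorm v.
Proof.
have le (x : R) : x ^+ 2 <= complex.Re (v k 0) ^+ 2 + complex.Im (v k 0) ^+ 2 ->
    `|x| <= enorm v.
  move=> xv; rewrite -sqrtr_sqr ler_wsqrtr// (bigD1 k)//=.
  apply: le_trans xv _; rewrite lerDl.
  by apply: sumr_ge0 => ? _; rewrite addr_ge0// sqr_ge0.
by rewrite /cnorm1 mulr_natl mulr2n lerD// le// ?lerDl ?lerDr sqr_ge0.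
Qed.

Lemma mxnorm1_le_enorm n (v : 'cV[R[i]]_n) :
  mxnorm1 v <= (2 * n%:R) * enorm v.
Proof.
apply: (@le_trans _ _ (\sum_(k < n) 2 * enorm v)).
  by apply: ler_sum => k _; rewrite big_ord1; exact: cnorm1_le_enorm.
by rewrite sumr_const card_ord -[leLHS]mulr_natr mulrAC.
Qed.

(** This bound makes the set whose supremum is the operator norm bounded, which
    both comparisons with [mxnorm1] require. *)
Lemma opnorm2_ubound n (A : 'M[R[i]]_n) (v : 'cV[R[i]]_n) : enorm v <= 1 ->
  enorm (A *m v) <= (2 * n%:R) * mxnorm1 A.
Proof.
move=> v1; apply: le_trans (enorm_le_mxnorm1 _) _.
apply: le_trans (mxnorm1M _ _) _; rewrite mulrC ler_wpM2r ?mxnorm1_ge0//.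
apply: le_trans (mxnorm1_le_enorm _) _.
by rewrite -[leRHS]mulr1 ler_wpM2l// mulr_ge0.
Qed.

Lemma opnorm2_le_mxnorm1 n (A : 'M[R[i]]_n) :
  opnorm2 A <= (2 * n%:R) * mxnorm1 A.
Proof.
apply: ge_sup; last by move=> _ [v v1 <-]; exact: opnorm2_ubound.
exists (enorm (A *m 0)), 0 => //; apply: le_trans (enorm_le_mxnorm1 _) _.
rewrite /mxnorm1 big1 ?ler01// => k _; rewrite big1// => l _.
by rewrite mxE /cnorm1 normr0 addr0.
Qed.

Lemma mxnorm1_le_opnorm2 n (A : 'M[R[i]]_n) :
  mxnorm1 A <= (2 * n%:R * n%:R) * opnorm2 A.
Proof.
have Akl k l : cnorm1 (A k l) <= 2 * opnorm2 A.
  have -> : A k l = (A *m (delta_mx l 0 : 'cV[R[i]]_n)) k 0.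
    by rewrite -colE mxE.
  apply: le_trans (cnorm1_le_enorm _ _) _; rewrite ler_wpM2l//.
  apply: ub_le_sup.
    exists ((2 * n%:R) * mxnorm1 A) => _ [v v1 <-]; exact: opnorm2_ubound.
  exists (delta_mx l 0) => //=.
  rewrite /enorm (bigD1 l)//= big1 => [|j jl]; last first.
    by rewrite !mxE (negbTE jl)/= expr0n addr0.
  by rewrite !mxE !eqxx/= expr1n expr0n !addr0 sqrtr1.
apply: (@le_trans _ _ (\sum_(k < n) \sum_(l < n) 2 * opnorm2 A)).
  by do 2!apply: ler_sum => ? _; exact: Akl.
by rewrite !sumr_const card_ord -!mulrnA -[leLHS]mulr_natr natrM; lra.
Qed.

End ComplexMatrixNorm.

(** * Linear differential equations for complex matrices *)

Section MatrixODE.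
Variable R : realType.
Implicit Types (t : R).

(** The scalar case of [is_derive_cmx]. *)
Definition is_derive_c (f : R -> R[i]) t (d : R[i]) : Prop :=
  is_derive t (1 : R) (fun s => complex.Re (f s)) (complex.Re d) /\
  is_derive t (1 : R) (fun s => complex.Im (f s)) (complex.Im d).

Lemma is_derive_c_cst (a : R[i]) t : is_derive_c (fun=> a) t 0.
Proof. by split; exact: is_derive_cst. Qed.

Lemma is_derive_c_add (f g : R -> R[i]) t a b :
  is_derive_c f t a -> is_derive_c g t b ->
  is_derive_c (fun s => f s + g s) t (a + b).
Proof.
move=> [f1 f2] [g1 g2]; split.
  under eq_fun do rewrite ReD; rewrite ReD; exact: is_derive_add.
under eq_fun do rewrite ImD; rewrite ImD; exact: is_derive_add.
Qed.

Lemma is_derive_c_mul (f g : R -> R[i]) t a b :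
  is_derive_c f t a -> is_derive_c g t b ->
  is_derive_c (fun s => f s * g s) t (a * g t + f t * b).
Proof.
move=> [f1 f2] [g1 g2]; split.
  under eq_fun do rewrite ReM.
  apply: (is_derive_eq (is_derive_sub (is_derive_mul f1 g1) (is_derive_mul f2 g2))).
  by rewrite ReD !ReM; ring.
under eq_fun do rewrite ImM.
apply: (is_derive_eq (is_derive_add (is_derive_mul f1 g2) (is_derive_mul f2 g1))).
by rewrite ImD !ImM; ring.
Qed.

Lemma is_derive_c_sum (I : Type) (s : seq I) (f : I -> R -> R[i])
    (d : I -> R[i]) t :
  (forall k, is_derive_c (f k) t (d k)) ->
  is_derive_c (fun x => \sum_(k <- s) f k x) t (\sum_(k <- s) d k).
Proof.
move=> fd; elim: s => [|k s IH].
  under eq_fun do rewrite big_nil; rewrite big_nil; exact: is_derive_c_cst.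
under eq_fun do rewrite big_cons; rewrite big_cons.
exact: is_derive_c_add.
Qed.

Variable n : nat.
Implicit Types (F G : R -> 'M[R[i]]_n) (A B : 'M[R[i]]_n).

Lemma is_derive_cmx_cst A t : is_derive_cmx (fun=> A) t 0.
Proof. by move=> k l; rewrite mxE; exact: is_derive_c_cst. Qed.

Lemma is_derive_cmx_mul F G t A B :
  is_derive_cmx F t A -> is_derive_cmx G t B ->
  is_derive_cmx (fun s => F s *m G s) t (A *m G t + F t *m B).
Proof.
move=> FA GB k l; have -> : (A *m G t + F t *m B) k l =
    \sum_j (A k j * G t j l + F t k j * B j l).
  by rewrite !mxE -big_split.
suff : is_derive_c (fun s => (F s *m G s) k l) t
    (\sum_j (A k j * G t j l + F t k j * B j l)) by [].
have -> : (fun s => (F s *m G s) k l) = (fun s => \sum_j F s k j * G s j l).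
  by apply/funext => s; rewrite mxE.
apply: (is_derive_c_sum _ (f := fun j s => F s k j * G s j l)) => j.
exact: is_derive_c_mul (FA k j) (GB j l).
Qed.

Lemma is_derive_cmx_0 F : (forall t, is_derive_cmx F t 0) -> forall t, F t = F 0.
Proof.
move=> F0 t; apply/matrixP => k l; apply/eqP; rewrite eq_complex.
apply/andP; split; apply/eqP.
  apply: (is_derive_0_is_cst t 0 (f := fun s => complex.Re (F s k l))) => s.
  by have [+ _] := F0 s k l; rewrite mxE.
apply: (is_derive_0_is_cst t 0 (f := fun s => complex.Im (F s k l))) => s.
by have [_ +] := F0 s k l; rewrite mxE.
Qed.

(** Phi is the inverse of the flow: for any solution G the product Phi G has
    derivative Phi A G - Phi A G = 0, hence is 1.  Applied to Psi itself this
    makes Psi the inverse of Phi, and so G = Psi. *)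
Lemma Gplus_eq (M : closedRiemannianManifold R) (a : M -> 'M[R[i]]_n)
    (rho : covector_family M) (Psi Phi : R -> 'M[R[i]]_n) :
  let A s := a (geodesic_flow s rho).1 in
  Psi 0 = 1%:M -> Phi 0 = 1%:M ->
  (forall t, is_derive_cmx Psi t (- (A t *m Psi t))) ->
  (forall t, is_derive_cmx Phi t (Phi t *m A t)) ->
  forall t, Gplus a t rho = Psi t.
Proof.
move=> A Psi0 Phi0 dPsi dPhi t.
have inv G : G 0 = 1%:M -> (forall s, is_derive_cmx G s (- (A s *m G s))) ->
    Phi t *m G t = 1%:M.
  move=> G0 dG; rewrite (is_derive_cmx_0 (F := fun s => Phi s *m G s)).
    by rewrite Phi0 G0 mulmx1.
  move=> s; have := is_derive_cmx_mul (dPhi s) (dG s).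
  by rewrite mulmxN mulmxA addrN.
rewrite /Gplus; case: xgetP => [G _ [G0 dG]|none]; last by case: (none Psi).
have := inv _ Psi0 dPsi => /mulmx1C PsiPhi.
by rewrite -[LHS]mul1mx -PsiPhi -mulmxA inv// mulmx1.
Qed.

(** exp(t lambda) *)
Definition cexp_line (lambda : R[i]) t : R[i] :=
  Complex (expR (complex.Re lambda * t) * cos (complex.Im lambda * t))
          (expR (complex.Re lambda * t) * sin (complex.Im lambda * t)).

Lemma cexp_line0 lambda : cexp_line lambda 0 = 1.
Proof. by rewrite /cexp_line !mulr0 expR0 cos0 sin0 mulr1 mulr0. Qed.

Lemma is_derive_cexp_line lambda t :
  is_derive_c (cexp_line lambda) t (lambda * cexp_line lambda t).
Proof.
set a := complex.Re lambda; set b := complex.Im lambda.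
have lin c : is_derive t 1 (fun s : R => c * s) c.
  apply: (is_derive_eq (is_derive_mul (is_derive_cst c t 1) (is_derive_id t 1))).
  by rewrite mul0r add0r mulr1.
have dexp : is_derive t 1 (fun s => expR (a * s)) (expR (a * t) * a).
  exact: (is_derive1_comp (f := expR) (g := fun s => a * s)).
split; [rewrite ReM|rewrite ImM].
  apply: (is_derive_eq (is_derive_mul dexp (is_derive_cos_comp (lin b)))).
  by rewrite /= -/a -/b; ring.
apply: (is_derive_eq (is_derive_mul dexp (is_derive_sin_comp (lin b)))).
by rewrite /= -/a -/b; ring.
Qed.

(** 1 <= |cos| + |sin| <= 2 *)
Lemma cnorm1_cexp_line lambda t :
  expR (complex.Re lambda * t) <= cnorm1 (cexp_line lambda t)
    <= 2 * expR (complex.Re lambda * t).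
Proof.
rewrite /cnorm1 /= !normrM ger0_norm ?expR_ge0// -mulrDr.
set e := expR _; have e0 : 0 < e by exact: expR_gt0.
set c := cos _; set s := sin _; apply/andP; split.
  rewrite -[leLHS]mulr1 ler_pM2l//.
  rewrite -(@ler_pXn2r _ 2)// ?nnegrE ?addr_ge0// expr1n -(cos2Dsin2 (complex.Im lambda * t)).
  rewrite -(real_normK (num_real (cos _))) -(real_normK (num_real (sin _))).
  by rewrite sqrrD addrAC lerDl mulrn_wge0// mulr_ge0.
rewrite mulrC ler_pM2r//; have := cos_max (complex.Im lambda * t).
by have := sin_max (complex.Im lambda * t); rewrite -/c -/s; lra.
Qed.

(** The exponential of t times a diagonal matrix. *)
Definition cexp_diag (lambda : 'rV[R[i]]_n) t : 'M[R[i]]_n :=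
  diag_mx (\row_k cexp_line (lambda 0 k) t).

Lemma is_derive_cexp_diag lambda t :
  is_derive_cmx (cexp_diag lambda) t (diag_mx lambda *m cexp_diag lambda t).
Proof.
move=> k l; rewrite mul_diag_mx !mxE.
have -> : (fun s => complex.Re (cexp_diag lambda s k l)) =
    (fun s => complex.Re (cexp_line (lambda 0 k) s *+ (k == l))).
  by apply/funext => s; rewrite !mxE.
have -> : (fun s => complex.Im (cexp_diag lambda s k l)) =
    (fun s => complex.Im (cexp_line (lambda 0 k) s *+ (k == l))).
  by apply/funext => s; rewrite !mxE.
case: eqVneq => _; rewrite ?mulr1n ?mulr0n; first exact: is_derive_cexp_line.
by rewrite mulr0; exact: is_derive_c_cst.
Qed.

End MatrixODE.

(** * Damping with constant coefficients in a rotating frame *)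

Section RotatingDamping.
Variables (R : realType) (n : nat).
Let M := round_circle R.
Implicit Types (t theta e r : R) (A B P : 'M[R[i]]_n).

(** r is the spectral abscissa of - B, up to sign: the slowest decay rate of
    exp(- t B).  Diagonalizability spares the polynomial factors of Jordan
    blocks. *)
Definition diagonalizable_with_abscissa B r : Prop :=
  exists P (lambda : 'rV[R[i]]_n),
    [/\ P \in unitmx, P *m B = diag_mx lambda *m P,
        forall k, r <= complex.Re (lambda 0 k) &
        exists k, complex.Re (lambda 0 k) = r].

Lemma diagonalization_inv P A B : P \in unitmx ->
  P *m B = A *m P -> invmx P *m A = B *m invmx P.
Proof.
by move=> Pu PB; apply: (can_inj (mulKmx Pu)); rewrite mulKVmx// mulmxA PB mulmxK.
Qed.

(** Used to deduce the backward direction D - K = (D + K)^T from the forward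
    one. *)
Lemma diagonalizable_with_abscissa_tr B r :
  diagonalizable_with_abscissa B r -> diagonalizable_with_abscissa B^T r.
Proof.
move=> [P [lambda [Pu PB rle rE]]]; exists (invmx P)^T, lambda; split=> //.
  by rewrite unitmx_tr unitmx_inv.
apply: (can_inj (@trmxK _ _ _)); rewrite !trmx_mul !trmxK tr_diag_mx.
by rewrite (diagonalization_inv Pu PB).
Qed.

Variables (U : R -> 'M[R[i]]_n) (K D : 'M[R[i]]_n) (b : R).
Hypothesis U0 : U 0 = 1%:M.
Hypothesis UD : forall s t, U (s + t) = U s *m U t.
Hypothesis dU : forall t, is_derive_cmx U t (K *m U t).
Hypothesis UK : forall t, U t *m K = K *m U t.
Hypothesis Ub : forall t, mxnorm1 (U t) <= b.
Variable a : M -> 'M[R[i]]_n.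
Hypothesis aE : forall theta, a (cis theta) = U theta *m D *m U (- theta).

Let UN t : U t *m U (- t) = 1%:M.
Proof. by rewrite -UD subrr. Qed.

Let NU t : U (- t) *m U t = 1%:M.
Proof. by rewrite -UD addNr. Qed.

Let dU_affine theta e t :
  is_derive_cmx (fun s => U (theta + e * s)) t (e%:C%C *: (K *m U (theta + e * t))).
Proof.
move=> k l; have [d1 d2] := dU (theta + e * t) k l.
have aff := is_derive_affine theta e t.
rewrite mxE ReM ImM /= !mul0r subr0 addr0 [e * complex.Re _]mulrC [e * complex.Im _]mulrC.
split; first exact: (is_derive1_comp (f := fun s => complex.Re (U s k l))).
exact: (is_derive1_comp (f := fun s => complex.Im (U s k l))).
Qed.

Section OneDirection.
Variables (e theta : R) (P : 'M[R[i]]_n) (lambda : 'rV[R[i]]_n).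
Hypothesis Pu : P \in unitmx.
Hypothesis PB : P *m (D + e%:C%C *: K) = diag_mx lambda *m P.

Let Psi t := U (theta + e * t) *m
  (invmx P *m (cexp_diag (- lambda) t *m (P *m U (- theta)))).
Let Phi t := (U theta *m invmx P) *m
  (cexp_diag lambda t *m (P *m U (- theta + - e * t))).

Let cexp_diag0 (mu : 'rV[R[i]]_n) : cexp_diag mu 0 = 1%:M.
Proof.
apply/matrixP => k l; rewrite !mxE cexp_line0.
by [].
Qed.

Let VPB : invmx P *m diag_mx lambda = (D + e%:C%C *: K) *m invmx P.
Proof. exact: diagonalization_inv. Qed.

(** In the frame that follows the orbit, U(theta + e t)^-1 G_t satisfies the
    equation H' = - (D + e K) H, which is solved by diagonalization. *)
Lemma Gplus_rotating t :
  Gplus a t (covector (cis theta) (e / 2)) = Psi t.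
Proof.
have flowE s : a (geodesic_flow s (covector (cis theta) (e / 2))).1 =
    U (theta + e * s) *m D *m U (- theta + - e * s).
  rewrite geodesic_flow_circle aE opprD mulNr.
  by rewrite [2 * _]mulrC divfK ?pnatr_eq0.
apply: (@Gplus_eq _ _ _ _ _ _ Phi) => [||s|s].
- by rewrite /Psi mulr0 addr0 cexp_diag0 mul1mx mulKmx// UN.
- by rewrite /Phi mulr0 addr0 cexp_diag0 mul1mx -!mulmxA mulKmx// UN.
- rewrite flowE; have := is_derive_cmx_mul (dU_affine theta e s)
    (is_derive_cmx_mul (is_derive_cmx_cst (invmx P) s)
      (is_derive_cmx_mul (is_derive_cexp_diag (- lambda) s)
        (is_derive_cmx_cst (P *m U (- theta)) s))).
  congr (is_derive_cmx _ _ _).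
  rewrite mulmx0 addr0 mul0mx add0r /Psi -UK.
  set V := U (theta + e * s); set V' := U (- theta + _).
  set W := P *m U (- theta); set E := cexp_diag (- lambda) s.
  have V'V : V' *m V = 1%:M.
    by rewrite /V /V' -UD -U0; congr U; ring.
  have -> : V *m D *m V' *m (V *m (invmx P *m (E *m W))) =
      V *m D *m (invmx P *m (E *m W)).
    by rewrite -[LHS]mulmxA (mulmxA V') V'V mul1mx.
  have -> : diag_mx (- lambda) = - diag_mx lambda by rewrite raddfN.
  rewrite mulNmx mulNmx !mulmxN -[_ *m E *m W]mulmxA.
  rewrite [invmx P *m (diag_mx lambda *m _)]mulmxA VPB -[(D + _) *m _ *m _]mulmxA.
  by rewrite mulmxDl mulmxDr opprD -!scalemxAl -scalemxAr !mulmxA addrCA subrr addr0.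
- rewrite flowE; have := is_derive_cmx_mul (is_derive_cmx_cst (U theta *m invmx P) s)
      (is_derive_cmx_mul (is_derive_cexp_diag lambda s)
        (is_derive_cmx_mul (is_derive_cmx_cst P s) (dU_affine (- theta) (- e) s))).
  congr (is_derive_cmx _ _ _).
  rewrite !mul0mx !add0r /Phi.
  set V := U (theta + e * s); set V' := U (- theta + _).
  set W := U theta *m invmx P; set E := cexp_diag lambda s.
  have V'V : V' *m V = 1%:M.
    by rewrite /V /V' -UD -U0; congr U; ring.
  have -> : W *m (E *m (P *m V')) *m (V *m D *m V') = W *m (E *m (P *m (D *m V'))).
    by rewrite -!mulmxA (mulmxA V') V'V mul1mx.
  have -> : diag_mx lambda *m E = E *m diag_mx lambda by exact: diag_mxC.
  congr (W *m _); rewrite -mulmxA [diag_mx lambda *m _]mulmxA -PB -mulmxDr; congr (E *m _).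
  rewrite -mulmxA -mulmxDr; congr (P *m _).
  by rewrite mulmxDl -scalemxAl rmorphN scaleNr addrK.
Qed.

End OneDirection.

Let mxnorm1_cexp_diag (lambda : 'rV[R[i]]_n) r t :
  (forall k, complex.Re (lambda 0 k) <= r) -> 0 <= t ->
  mxnorm1 (cexp_diag lambda t) <= 2 * n%:R * expR (r * t).
Proof.
move=> lr t0; apply: (@le_trans _ _ (\sum_(k < n) 2 * expR (r * t))); last first.
  by rewrite sumr_const card_ord -[leLHS]mulr_natr mulrAC.
apply: ler_sum => k _; rewrite (bigD1 k)//= big1 => [|l lk]; last first.
  by rewrite !mxE eq_sym (negbTE lk) /cnorm1 normr0 addr0.
rewrite addr0 !mxE eqxx mulr1n.
have /andP[_ le2] := cnorm1_cexp_line (lambda 0 k) t; apply: le_trans le2 _.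
by rewrite ler_pM2l// ler_expR ler_wpM2r.
Qed.

(** Psi and the diagonal exponential are conjugate up to the bounded matrices U
    and P, so that the norms of the two are comparable uniformly in theta and
    t. *)
Lemma Gplus_rotating_bounds e r :
  diagonalizable_with_abscissa (D + e%:C%C *: K) r ->
  exists m m' : R, 0 < m /\ forall theta t, 0 < t ->
    m * expR (- (r * t)) <=
      opnorm2 (Gplus a t (covector (cis theta) (e / 2))) <= m' * expR (- (r * t)).
Proof.
move=> [P [lambda [Pu PB rle [k0 k0E]]]].
have b0 : 0 <= b := le_trans (mxnorm1_ge0 _) (Ub 0).
pose c := mxnorm1 P * b * b * mxnorm1 (invmx P).
have c0 : 0 <= c by rewrite !mulr_ge0// mxnorm1_ge0.
have n0 : 0 < n%:R :> R by rewrite ltr0n (leq_ltn_trans _ (ltn_ord k0)).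
exists ((1 + c) * (2 * n%:R * n%:R))^-1, (2 * n%:R * (c * (2 * n%:R))).
split=> [|theta t t0].
  by rewrite invr_gt0 !mulr_gt0// ltr_wpDr.
rewrite (Gplus_rotating _ Pu PB); set W := cexp_diag _ t.
set Psi := U _ *m _; apply/andP; split.
  have WE : W = P *m (U (- (theta + e * t)) *m (Psi *m (U theta *m invmx P))).
    rewrite /Psi -!mulmxA [U (- _) *m (U _ *m _)]mulmxA NU mul1mx.
    by rewrite [U (- theta) *m (U _ *m _)]mulmxA NU mul1mx mulKVmx// mulmxV// mulmx1.
  rewrite ler_pdivrMl; last by rewrite !mulr_gt0// ltr_wpDr.
  apply: (@le_trans _ _ (mxnorm1 W)).
    have := mxnorm1_entry W k0 k0; apply: le_trans.
    rewrite !mxE eqxx mulr1n.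
    have /andP[le1 _] := cnorm1_cexp_line (- lambda 0 k0) t; apply: le_trans le1.
    by have [-> _] : complex.Re (- lambda 0 k0) = - r /\ True; rewrite ?mulNr//
      -k0E; case: (lambda 0 k0).
  apply: (@le_trans _ _ (c * mxnorm1 Psi)).
    rewrite {1}WE; apply: le_trans (mxnorm1M _ _) _.
    rewrite (_ : c * _ = mxnorm1 P * (b * (mxnorm1 Psi * (b * mxnorm1 (invmx P))))).
      rewrite ler_wpM2l ?mxnorm1_ge0//; apply: le_trans (mxnorm1M _ _) _.
      rewrite ler_pM ?mxnorm1_ge0//; apply: le_trans (mxnorm1M _ _) _.
      rewrite ler_wpM2l ?mxnorm1_ge0//; apply: le_trans (mxnorm1M _ _) _.
      by rewrite ler_wpM2r ?mxnorm1_ge0.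
    by rewrite /c; ring.
  apply: (@le_trans _ _ ((1 + c) * mxnorm1 Psi)).
    by rewrite ler_wpM2r ?mxnorm1_ge0// lerDr.
  rewrite -[leRHS]mulrA ler_wpM2l ?addr_ge0//; exact: mxnorm1_le_opnorm2.
apply: le_trans (opnorm2_le_mxnorm1 _) _; rewrite -[leRHS]mulrA ler_wpM2l ?mulr_ge0//.
have WN : mxnorm1 W <= 2 * n%:R * expR (- (r * t)).
  rewrite -mulNr; apply: mxnorm1_cexp_diag; last exact: ltW.
  by move=> k; have := rle k; rewrite mxE; case: (lambda 0 k) => x y /=; rewrite lerN2.
rewrite (_ : _ * expR _ = b * (mxnorm1 (invmx P) *
    ((2 * n%:R * expR (- (r * t))) * (mxnorm1 P * b)))); last by rewrite /c; ring.
apply: le_trans (mxnorm1M _ _) _; rewrite ler_pM ?mxnorm1_ge0//.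
apply: le_trans (mxnorm1M _ _) _; rewrite ler_wpM2l ?mxnorm1_ge0//.
apply: le_trans (mxnorm1M _ _) _; rewrite ler_pM ?mxnorm1_ge0//.
apply: le_trans (mxnorm1M _ _) _; by rewrite ler_wpM2l ?mxnorm1_ge0.
Qed.

Theorem C_infty_rotating r : D^T = D -> K^T = - K ->
  diagonalizable_with_abscissa (D + K) r -> C_infty a = r.
Proof.
move=> DT KT Br.
have Br1 : diagonalizable_with_abscissa (D + (1 : R)%:C%C *: K) r by rewrite scale1r.
have BrN1 : diagonalizable_with_abscissa (D + (-1 : R)%:C%C *: K) r.
  have := diagonalizable_with_abscissa_tr Br.
  by rewrite linearD /= DT KT rmorphN1 scaleN1r.
have [m1 [m1' [m10 b1]]] := Gplus_rotating_bounds Br1.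
have [m2 [m2' [m20 b2]]] := Gplus_rotating_bounds BrN1.
apply: (@C_infty_exponential _ _ _ a r (Num.min m1 m2) (Num.max m1' m2')).
- by rewrite lt_min m10 m20.
- exists (covector (cis 0) (2^-1)); apply/cosphere_covector.
  by rewrite ger0_norm.
move=> t rho t0 Srho; have [c rhoE] := cotangentP Srho.1.
move: Srho; rewrite rhoE => /cosphere_covector c2.
have [theta _ <-] := cis_surj rho.1.
have e0 : 0 <= expR (- (r * t)) by exact: expR_ge0.
have [c0|c0] := lerP 0 c.
  have -> : c = 1 / 2 by rewrite div1r -c2 ger0_norm.
  have /andP[l u] := b1 theta t t0; apply/andP; split.
    by apply: le_trans l; rewrite ler_wpM2r// ge_min lexx.
  by apply: le_trans u _; rewrite ler_wpM2r// le_max lexx.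
have -> : c = -1 / 2 by move: c2; rewrite ltr0_norm// => c2; rewrite mulN1r -c2 opprK.
have /andP[l u] := b2 theta t t0; apply/andP; split.
  by apply: le_trans l; rewrite ler_wpM2r// ge_min lexx orbT.
by apply: le_trans u _; rewrite ler_wpM2r// le_max lexx orbT.
Qed.

End RotatingDamping.

(** * Dampings rotated by Rodrigues' formula *)

Section Rodrigues.
Local Open Scope sesquilinear_scope.
Variables (R : realType) (n : nat).
Let M := round_circle R.
Implicit Types (t theta s : R) (p : circle R).
Local Notation RC := (map_mx (real_complex R)).

(** exp(theta K) at the point of angle theta, when K^3 = - K.  Being a function
    of the coordinates cos theta and sin theta it is defined on the circle. *)
Definition frame (K : 'M[R]_n) p : 'M[R]_n :=
  1%:M + (circle_val p).2 *: K + (1 - (circle_val p).1) *: (K *m K).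

Definition rotating_gram (K L : 'M[R]_n) (s : R) (p : M) : 'M[R[i]]_n :=
  s%:C%C *: RC (frame K p *m L *m (frame K p *m L)^T).

Lemma Re_scaled_real s (A : 'M[R]_n) k l :
  complex.Re ((s%:C%C *: RC A) k l) = s * A k l.
Proof. by rewrite 2!mxE ReM /= mul0r subr0. Qed.

Lemma Im_scaled_real s (A : 'M[R]_n) k l :
  complex.Im ((s%:C%C *: RC A) k l) = 0.
Proof. by rewrite 2!mxE ImM /= mulr0 mul0r addr0. Qed.

Lemma psd_gram m s (B : 'M[R]_(n, m)) : 0 <= s -> psd (s%:C%C *: RC (B *m B^T)).
Proof.
move=> s0.
have conjRC (d d' : nat) (A : 'M[R]_(d, d')) : map_mx Num.conj (RC A) = RC A.
  apply/matrixP => k l; rewrite !mxE conj_Creal//; apply/complex_realP.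
  by exists (A k l).
split.
  apply/is_hermitianmxP; rewrite expr0 scale1r -map_mxZ -map_trmx conjRC.
  by rewrite map_trmx linearZ /= trmx_mul trmxK.
move=> v; rewrite -scalemxAr -scalemxAl mxE mulr_ge0 ?ler0c//.
pose w := RC B^T *m v.
have -> : v ^t* *m RC (B *m B^T) *m v = w ^t* *m w.
  rewrite map_mxM /w trmx_mul map_trmx trmxK map_mxM conjRC.
  by rewrite !mulmxA.
rewrite mxE sumr_ge0// => k _; rewrite !mxE mulrC; exact: mul_conjC_ge0.
Qed.

(** The generators contain a phase so that both charts, which differ by a
    rotation of angle pi, are covered; the products make the set closed under
    derivation and under matrix products. *)
Inductive trig_poly : (R -> R) -> Prop :=
| trig_cst c : trig_poly (fun=> c)
| trig_cos c : trig_poly (fun t => cos (t + c))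
| trig_sin c : trig_poly (fun t => sin (t + c))
| trig_add f g : trig_poly f -> trig_poly g -> trig_poly (fun t => f t + g t)
| trig_mul f g : trig_poly f -> trig_poly g -> trig_poly (fun t => f t * g t).

Lemma trig_poly_derive f : trig_poly f ->
  exists2 f', trig_poly f' & forall t, is_derive t 1 f (f' t).
Proof.
have sh c t : is_derive t 1 (fun x : R => x + c) 1.
  by apply: (is_derive_eq (is_derive_add (is_derive_id t 1) (is_derive_cst c t 1))); rewrite addr0.
elim=> {f} [c|c|c|f g tf [f' tf' df] tg [g' tg' dg]|f g tf [f' tf' df] tg [g' tg' dg]].
- by exists (fun=> 0) => [|t]; [exact: trig_cst|exact: is_derive_cst].
- exists (fun t => (-1) * sin (t + c)) => [|t].
    exact: trig_mul (trig_cst _) (trig_sin _).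
  by apply: (is_derive_eq (is_derive_cos_comp (sh c t))); rewrite mulr1 mulN1r.
- exists (fun t => cos (t + c)) => [|t]; first exact: trig_cos.
  by apply: (is_derive_eq (is_derive_sin_comp (sh c t))); rewrite mulr1.
- by exists (fun t => f' t + g' t) => [|t]; [exact: trig_add|exact: is_derive_add].
exists (fun t => f' t * g t + f t * g' t) => [|t]; last exact: is_derive_mul.
by apply: trig_add; exact: trig_mul.
Qed.

Lemma trig_poly_sum (I : Type) (r : seq I) (f : I -> R -> R) :
  (forall k, trig_poly (f k)) -> trig_poly (fun t => \sum_(k <- r) f k t).
Proof.
move=> tf; elim: r => [|k r IH].
  by under eq_fun do rewrite big_nil; exact: trig_cst.
by under eq_fun do rewrite big_cons; exact: trig_add.
Qed.

Lemma trig_poly_mulmx q (A B : R -> 'M[R]_q) :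
  (forall k l, trig_poly (fun t => A t k l)) ->
  (forall k l, trig_poly (fun t => B t k l)) ->
  forall k l, trig_poly (fun t => (A t *m B t) k l).
Proof.
move=> tA tB k l; under eq_fun do rewrite mxE.
apply: (trig_poly_sum _ (f := fun j t => A t k j * B t j l)) => j.
exact: trig_mul.
Qed.

Lemma trig_poly_smooth (f : M -> R) :
  (forall c, trig_poly (fun t => f (cis (t + c)))) -> smooth_function f.
Proof.
move=> tf b.
exact: (@smooth_coord R _ trig_poly trig_poly_derive _ (@chart_cod R M b)
  (tf (pi *+ b))).
Qed.

Lemma damping_rotating_gram K L s : 0 <= s -> damping (rotating_gram K L s).
Proof.
move=> s0; split=> [p|k l]; first exact: psd_gram.
split; apply: trig_poly_smooth => c; last first.
  by under eq_fun do rewrite /rotating_gram Im_scaled_real; exact: trig_cst.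
have tF i j : trig_poly (fun t => frame K (cis (t + c)) i j).
  under eq_fun do rewrite /frame !cisE 2!mxE [X in _ + X + _]mxE [X in _ + X]mxE.
  apply: trig_add; first apply: trig_add.
  - exact: trig_cst.
  - exact: trig_mul (trig_sin _) (trig_cst _).
  apply: trig_mul (trig_cst _).
  under eq_fun do rewrite -mulN1r.
  exact: trig_add (trig_cst _) (trig_mul (trig_cst _) (trig_cos _)).
have tFL := trig_poly_mulmx tF (fun i j => trig_cst (L i j)).
have tFLT i j : trig_poly (fun t => (frame K (cis (t + c)) *m L)^T i j).
  by under eq_fun do rewrite mxE; exact: tFL.
have := trig_mul (trig_cst s) (trig_poly_mulmx tFL tFLT k l).
congr trig_poly; apply/funext => t.
by rewrite (Re_scaled_real _ _ k l).
Qed.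

Variable K : 'M[R]_n.
Hypothesis K3 : K *m K *m K = - K.
Hypothesis KT : K^T = - K.

Let U theta : 'M[R[i]]_n := RC (frame K (cis theta)).

Let frameE theta : frame K (cis theta) =
  1%:M + sin theta *: K + (1 - cos theta) *: (K *m K).
Proof. by rewrite /frame cisE. Qed.

(** The addition formulas, in the commutative algebra generated by K. *)
Lemma frameD s t : frame K (cis (s + t)) = frame K (cis s) *m frame K (cis t).
Proof.
rewrite !frameE; have K3' : K *m (K *m K) = - K by rewrite mulmxA.
have K4 : K *m K *m (K *m K) = - (K *m K) by rewrite mulmxA K3 mulNmx.
rewrite !(mulmxDl, mulmxDr, mul1mx, mulmx1) -!scalemxAl -!scalemxAr.
rewrite K3 K3' K4 cosD sinD; set K2 := K *m K.
by apply/matrixP => k l; rewrite !mxE; ring.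
Qed.

Lemma frame_tr theta : (frame K (cis theta))^T = frame K (cis (- theta)).
Proof.
rewrite !frameE !linearD /= !linearZ /= trmx_mul KT mulNmx mulmxN opprK trmx1.
by rewrite sinN cosN scalerN scaleNr.
Qed.

Lemma C_infty_rotating_gram (L : 'M[R]_n) s r :
  diagonalizable_with_abscissa (RC (s *: (L *m L^T) + K)) r ->
  C_infty (rotating_gram K L s) = r.
Proof.
move=> Kr; pose K2 := K *m K.
apply: (@C_infty_rotating _ _ U (RC K) (RC (s *: (L *m L^T)))
  (\sum_k \sum_l (`|(1%:M : 'M[R]_n) k l| + `|K k l| + 2 * `|K2 k l|))).
- by rewrite /U frameE sin0 cos0 subrr !scale0r !addr0 map_mx1.
- by move=> t t'; rewrite /U frameD map_mxM.
- move=> t k l.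
  have ReE : (fun x => complex.Re (U x k l)) = (fun x => (1%:M : 'M[R]_n) k l +
      sin x * K k l + (1 - cos x) * K2 k l).
    by apply/funext => x; rewrite /U frameE !mxE.
  have ImE : (fun x => complex.Im (U x k l)) = (fun=> 0).
    by apply/funext => x; rewrite mxE.
  have dE : RC K *m U t = RC (cos t *: K + sin t *: K2).
    rewrite /U -map_mxM frameE !mulmxDr mulmx1 -!scalemxAr mulmxA K3.
    congr map_mx; apply/matrixP => i j; rewrite !mxE; ring.
  have dkl : (RC K *m U t) k l = (cos t * K k l + sin t * K2 k l)%:C%C.
    by rewrite dE mxE mxE [X in X + _]mxE [X in _ + X]mxE.
  rewrite ReE ImE dkl /=; split; last exact: is_derive_cst.
  have dc (c : R) : is_derive t 1 (fun=> c) 0 by exact: is_derive_cst.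
  apply: is_derive_eq (is_derive_add (is_derive_add (dc _)
     (is_derive_mul (is_derive_sin t) (dc (K k l))))
     (is_derive_mul (is_derive_sub (dc 1) (is_derive_cos t)) (dc (K2 k l)))) _.
  by ring.
- by move=> t; rewrite /U -!map_mxM; congr map_mx; rewrite frameE
    !(mulmxDl, mulmxDr) mul1mx mulmx1 -!scalemxAr -!scalemxAl mulmxA.
- move=> t; do 2!apply: ler_sum => ? _; rewrite /cnorm1 /U mxE /= normr0 addr0 frameE.
  rewrite mxE [X in X + _]mxE [X in _ + X + _]mxE [X in _ + X]mxE -/K2.
  apply: le_trans (ler_normD _ _) _; apply: lerD.
    apply: le_trans (ler_normD _ _) _; rewrite lerD// normrM ler_piMl//.
    exact: sin_max.
  rewrite normrM ler_wpM2r//; have := cos_le1 t; have := cos_geN1 t.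
  by rewrite ler_norml => *; apply/andP; split; lra.
- move=> t; rewrite /rotating_gram /U map_mxZ -scalemxAr -scalemxAl -!map_mxM.
  by rewrite -frame_tr trmx_mul !mulmxA.
- by rewrite map_trmx linearZ /= trmx_mul trmxK.
- by rewrite map_trmx KT map_mxN.
- by rewrite -map_mxD.
Qed.

End Rodrigues.

(** * Small determinants and distinct eigenvalues *)

Lemma det_mx2 (T : comPzRingType) (A : 'M[T]_2) :
  \det A = A ord0 ord0 * A (lift ord0 ord0) (lift ord0 ord0) -
           A ord0 (lift ord0 ord0) * A (lift ord0 ord0) ord0.
Proof.
rewrite (expand_det_row _ ord0) !big_ord_recl big_ord0 /cofactor !det_mx11 !mxE.
have l1 : lift (lift ord0 ord0 : 'I_2) (0 : 'I_1) = ord0 by apply: val_inj.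
by rewrite l1 /= /bump /=; ring.
Qed.

Lemma det_mx3 (T : comPzRingType) (A : 'M[T]_3) :
  let i0 := ord0 in let i1 := lift ord0 ord0 in let i2 := lift ord0 (lift ord0 ord0) in
  \det A = A i0 i0 * (A i1 i1 * A i2 i2 - A i1 i2 * A i2 i1)
    - A i0 i1 * (A i1 i0 * A i2 i2 - A i1 i2 * A i2 i0)
    + A i0 i2 * (A i1 i0 * A i2 i1 - A i1 i1 * A i2 i0).
Proof.
move=> i0 i1 i2.
rewrite (expand_det_row _ ord0) !big_ord_recl big_ord0 /cofactor !det_mx2 !mxE.
have e1 : lift i1 (ord0 : 'I_2) = ord0 by apply: val_inj.
have e2 : lift i1 (lift ord0 ord0 : 'I_2) = i2 by apply: val_inj.
have e3 : lift i2 (ord0 : 'I_2) = ord0 by apply: val_inj.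
have e4 : lift i2 (lift ord0 ord0 : 'I_2) = i1 by apply: val_inj.
rewrite -/i1 -/i2 e1 e2 e3 e4 /= /bump /=; ring.
Qed.

Section DistinctEigenvalues.
Variables (R : realType) (n : nat).

(** Let P have eigenvectors of B as its rows.  If w P = 0 then w p(Lambda) P =
    w P p(B) = 0 for every polynomial p; taking for p the product of the X -
    lambda_j with j distinct from k isolates the k-th row of P, which is not
    zero, so w_k = 0 and P is invertible. *)
Lemma distinct_eigenvalues_diagonalizable (B : 'M[R[i]]_n)
    (lambda : 'rV[R[i]]_n) (r : R) :
  (forall k l, lambda 0 k = lambda 0 l -> k = l) ->
  (forall k, eigenvalue B (lambda 0 k)) ->
  (forall k, r <= complex.Re (lambda 0 k)) ->
  (exists k, complex.Re (lambda 0 k) = r) ->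
  diagonalizable_with_abscissa B r.
Proof.
move=> linj eigB rle rE.
have /choice[v vP] : forall k, exists v : 'rV_n,
    v *m B = lambda 0 k *: v /\ v != 0.
  by move=> k; have /eigenvalueP[v] := eigB k; exists v.
pose P := \matrix_k v k.
have PB : P *m B = diag_mx lambda *m P.
  apply/row_matrixP => k; rewrite row_mul rowK (vP k).1.
  by rewrite row_mul row_diag_mx -scalemxAl -rowE rowK.
exists P, lambda; split=> //.
have annih (s : seq 'I_n) (w : 'rV_n) : w *m P = 0 ->
    (\row_k (w 0 k * \prod_(j <- s) (lambda 0 k - lambda 0 j))) *m P = 0.
  elim: s w => [|j s IH] w wP.
    rewrite -[RHS]wP; congr (_ *m P); apply/rowP => k.
    by rewrite mxE big_nil mulr1.
  have := IH (w *m (diag_mx lambda - (lambda 0 j)%:M)); rewrite -mulmxA mulmxBl -PB.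
  rewrite mul_scalar_mx mulmxBr mulmxA wP mul0mx sub0r -scalemxAr wP scaler0 oppr0.
  move=> /(_ erefl) <-; congr (_ *m P); apply/rowP => k.
  rewrite !mxE big_cons mulrA; congr (_ * _).
  rewrite (bigD1 k)//= big1 => [|l lk]; last by rewrite !mxE (negbTE lk) subr0 mulr0.
  by rewrite !mxE eqxx addr0.
rewrite -row_free_unit -kermx_eq0; apply/eqP/row_matrixP => k0; rewrite row0.
set w := row k0 _; have wP : w *m P = 0 by rewrite -row_mul mulmx_ker row0.
apply/rowP => k; rewrite [RHS]mxE.
have := annih [seq j <- enum 'I_n | j != k] w wP.
set u := \row_j _; have uE : u = u 0 k *: delta_mx 0 k.
  apply/rowP => l; rewrite [RHS]mxE [X in _ = _ * X]mxE eqxx /=.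
  have [->|lk] := eqVneq l k; first by rewrite mulr1.
  rewrite mulr0 mxE; apply/eqP; rewrite mulf_eq0; apply/orP; right.
  rewrite (big_rem l)/= ?subrr ?mul0r//.
  by rewrite mem_filter lk mem_enum.
rewrite uE -scalemxAl -rowE rowK => /eqP; rewrite scaler_eq0 (negbTE (vP k).2) orbF.
rewrite mxE mulf_eq0 => /orP[/eqP //|].
rewrite prodf_seq_eq0 => /hasP[j]; rewrite mem_filter => /andP[jk _] /=.
by rewrite subr_eq0 => /eqP/linj kj; rewrite kj eqxx in jk.
Qed.

End DistinctEigenvalues.

(** * Two examples in dimension three *)

Section Examples.
Variable R : realType.
Let M := round_circle R.
Local Notation RC := (map_mx (real_complex R)).

Definition mx3 (T : Type) (a11 a12 a13 a21 a22 a23 a31 a32 a33 : T) : 'M[T]_3 :=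
  \matrix_(i < 3, j < 3)
    nth a11 (nth [::] [:: [:: a11; a12; a13]; [:: a21; a22; a23];
                          [:: a31; a32; a33]] i) j.

Lemma ord3P (Q : 'I_3 -> Prop) :
  Q ord0 -> Q (lift ord0 ord0) -> Q (lift ord0 (lift ord0 ord0)) ->
  forall k, Q k.
Proof.
move=> Q0 Q1 Q2 [[|[|[|//]]] k3].
- by move: Q0; congr Q; exact: val_inj.
- by move: Q1; congr Q; exact: val_inj.
by move: Q2; congr Q; exact: val_inj.
Qed.

(** The left-hand side is the characteristic polynomial of D + K at mu,
    where D is tridiagonal and K rotates the last two coordinates. *)
Lemma eigenvalue_tridiagonal (h x b z g : R) (mu : R[i]) :
  (mu - h%:C%C) * ((mu - b%:C%C) * (mu - g%:C%C) + 1 - z%:C%C ^+ 2)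
    - x%:C%C ^+ 2 * (mu - g%:C%C) = 0 ->
  eigenvalue (RC (mx3 h x 0 x b (z - 1) 0 (z + 1) g)) mu.
Proof.
move=> mu0; apply/eigenvalueP.
have /det0P[v v0 vB] : \det (mu%:M - RC (mx3 h x 0 x b (z - 1) 0 (z + 1) g)) == 0.
  apply/eqP; rewrite -[RHS]mu0 det_mx3 !mxE /= !mulr1n !mulr0n.
  by rewrite !(rmorphB, rmorphD) /= rmorph0 rmorph1; ring.
exists v => //; move/eqP: vB; rewrite mulmxBr subr_eq0 => /eqP <-.
by rewrite mul_mx_scalar.
Qed.

Definition rotation_generator : 'M[R]_3 := mx3 0 0 0 0 0 (-1) 0 1 0.

Lemma rotation_generator3 :
  rotation_generator *m rotation_generator *m rotation_generator =
  - rotation_generator.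
Proof.
apply/matrixP; do 2!apply: ord3P;
  by rewrite !mxE !big_ord_recl !big_ord0 !mxE !big_ord_recl !big_ord0 !mxE /=; ring.
Qed.

Lemma rotation_generator_tr : rotation_generator^T = - rotation_generator.
Proof.
by apply/matrixP; do 2!apply: ord3P; rewrite !mxE /= ?oppr0 ?opprK.
Qed.

(** The hypotheses are Vieta's relations for the characteristic polynomial. *)
Lemma tridiagonal_eigenvalues (h x b z g : R) (l1 l2 l3 : R[i]) :
  (h + b + g)%:C%C = l1 + l2 + l3 ->
  (h * b + h * g + b * g - x ^+ 2 - z ^+ 2 + 1)%:C%C = l1 * l2 + l1 * l3 + l2 * l3 ->
  (h * (b * g - z ^+ 2 + 1) - x ^+ 2 * g)%:C%C = l1 * l2 * l3 ->
  forall mu, mu \in [:: l1; l2; l3] ->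
  eigenvalue (RC (mx3 h x 0 x b (z - 1) 0 (z + 1) g)) mu.
Proof.
move=> e1 e2 e3 mu mul; apply: eigenvalue_tridiagonal.
transitivity (mu ^+ 3 - (h + b + g)%:C%C * mu ^+ 2 +
  (h * b + h * g + b * g - x ^+ 2 - z ^+ 2 + 1)%:C%C * mu -
  (h * (b * g - z ^+ 2 + 1) - x ^+ 2 * g)%:C%C).
  rewrite !(rmorphB, rmorphD, rmorphM, rmorphXn) /= rmorph1; ring.
rewrite e1 e2 e3; move: mul; rewrite !inE => /or3P[] /eqP ->; ring.
Qed.

Lemma C_infty_tridiagonal (L : 'M[R]_3) (s h x b z g : R) (l1 l2 l3 : R[i]) :
  s *: (L *m L^T) = mx3 h x 0 x b z 0 z g ->
  (h + b + g)%:C%C = l1 + l2 + l3 ->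
  (h * b + h * g + b * g - x ^+ 2 - z ^+ 2 + 1)%:C%C = l1 * l2 + l1 * l3 + l2 * l3 ->
  (h * (b * g - z ^+ 2 + 1) - x ^+ 2 * g)%:C%C = l1 * l2 * l3 ->
  [/\ l1 != l2, l1 != l3 & l2 != l3] ->
  complex.Re l1 <= complex.Re l2 -> complex.Re l1 <= complex.Re l3 ->
  C_infty (rotating_gram rotation_generator L s) = complex.Re l1.
Proof.
move=> DE e1 e2 e3 [l12 l13 l23] re2 re3.
apply: C_infty_rotating_gram.
- exact: rotation_generator3.
- exact: rotation_generator_tr.
have -> : s *: (L *m L^T) + rotation_generator =
    mx3 h x 0 x b (z - 1) 0 (z + 1) g.
  by rewrite DE; apply/matrixP; do 2!apply: ord3P; rewrite !mxE /= ?addr0 ?add0r.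
apply: (distinct_eigenvalues_diagonalizable
  (lambda := \row_k nth 0 [:: l1; l2; l3] k)).
- do 2!apply: ord3P; rewrite !mxE //= => /eqP; rewrite ?(negbTE l12)
    ?(negbTE l13) ?(negbTE l23)// eq_sym ?(negbTE l12) ?(negbTE l13)
    ?(negbTE l23)//.
- move=> k; rewrite mxE; apply: (tridiagonal_eigenvalues e1 e2 e3).
  by apply: mem_nth; case: k.
- by apply: ord3P; rewrite !mxE.
by exists ord0; rewrite mxE.
Qed.

Lemma C_infty_real_spectrum (L : 'M[R]_3) (s h x b z g l1 l2 l3 : R) :
  s *: (L *m L^T) = mx3 h x 0 x b z 0 z g ->
  h + b + g = l1 + l2 + l3 ->
  h * b + h * g + b * g - x ^+ 2 - z ^+ 2 + 1 = l1 * l2 + l1 * l3 + l2 * l3 ->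
  h * (b * g - z ^+ 2 + 1) - x ^+ 2 * g = l1 * l2 * l3 ->
  l1 < l2 < l3 ->
  C_infty (rotating_gram rotation_generator L s) = l1.
Proof.
move=> DE e1 e2 e3 /andP[l12 l23]; have l13 := lt_trans l12 l23.
rewrite (C_infty_tridiagonal (l1 := l1%:C%C) (l2 := l2%:C%C) (l3 := l3%:C%C) DE)
  ?e1 ?e2 ?e3 ?rmorphD ?rmorphM ?(ltW l12) ?(ltW l13)//.
by split; rewrite (inj_eq (@complexI R)) lt_eqF.
Qed.

(** N is the squared modulus of the two conjugate eigenvalues and p their real
    part. *)
Lemma C_infty_complex_spectrum (L : 'M[R]_3) (s h x b z g l p N : R) :
  s *: (L *m L^T) = mx3 h x 0 x b z 0 z g ->
  h + b + g = l + 2 * p ->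
  h * b + h * g + b * g - x ^+ 2 - z ^+ 2 + 1 = 2 * p * l + N ->
  h * (b * g - z ^+ 2 + 1) - x ^+ 2 * g = l * N ->
  p ^+ 2 < N ->
  C_infty (rotating_gram rotation_generator L s) = Num.min l p.
Proof.
move=> DE e1 e2 e3 pN; pose q := Num.sqrt (N - p ^+ 2).
have q0 : 0 < q by rewrite sqrtr_gt0 subr_gt0.
have NE : N = p ^+ 2 + q ^+ 2 by rewrite sqr_sqrtr ?subr_ge0 ?ltW// addrC subrK.
pose m1 : R[i] := l%:C%C; pose m2 := Complex p q; pose m3 := Complex p (- q).
have d12 : m1 != m2 by apply/eqP => -[_ q0']; move: q0; rewrite -q0' ltxx.
have d13 : m1 != m3 by apply/eqP => -[_ q0']; move: q0; lra.
have d23 : m2 != m3 by apply/eqP => -[q0']; move: q0; lra.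
have s1 : (h + b + g)%:C%C = m1 + m2 + m3.
  by rewrite e1; apply/eqP; rewrite eq_complex /=; apply/andP; split; apply/eqP; ring.
have s2 : (h * b + h * g + b * g - x ^+ 2 - z ^+ 2 + 1)%:C%C =
    m1 * m2 + m1 * m3 + m2 * m3.
  by rewrite e2 NE; apply/eqP; rewrite eq_complex /=; apply/andP; split; apply/eqP; ring.
have s3 : (h * (b * g - z ^+ 2 + 1) - x ^+ 2 * g)%:C%C = m1 * m2 * m3.
  by rewrite e3 NE; apply/eqP; rewrite eq_complex /=; apply/andP; split; apply/eqP; ring.
have [lp|pl] := leP l p.
  exact: (C_infty_tridiagonal (l1 := m1) (l2 := m2) (l3 := m3) DE).
rewrite (C_infty_tridiagonal (l1 := m2) (l2 := m1) (l3 := m3) DE) ?(ltW pl)//.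
- by rewrite s1; ring.
- by rewrite s2; ring.
- by rewrite s3; ring.
by rewrite eq_sym d12 d13 d23.
Qed.

Lemma rotating_gramZ (K L : 'M[R]_3) (c s : R) :
  (fun p : M => c%:C%C *: rotating_gram K L s p) = rotating_gram K L (c * s).
Proof.
apply/funext => p; rewrite /rotating_gram scalerA.
by rewrite -[in LHS](rmorphM (real_complex R)).
Qed.

Lemma rotating_gram2 (K L : 'M[R]_3) (s : R) :
  (fun p : M => 2%:R *: rotating_gram K L s p) = rotating_gram K L (2 * s).
Proof. by rewrite -rotating_gramZ rmorph_nat. Qed.

Lemma rotating_gramD (K L : 'M[R]_3) (s : R) :
  (fun p : M => rotating_gram K L s p + rotating_gram K L s p) =
  rotating_gram K L (2 * s).
Proof. by rewrite -rotating_gram2; apply/funext => p; rewrite scaler_nat. Qed.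

(** Up to the factor s, the damping is 4 on the fixed axis, which only
    contributes the eigenvalue 4 s, and [[5, 3], [3, 2]] in the rotating plane.
    For s = 1/3 the plane block of D + K is [[5/3, 0], [2, 2/3]], with the eigenvalues
    2/3 and 5/3, while that of 2 D + K is [[10/3, 1], [3, 4/3]], with the
    eigenvalues 1/3 and 13/3. *)
Definition overdamped_factor : 'M[R]_3 := mx3 2 0 0 0 2 1 0 1 1.

(** D is s times the rank-one matrix w w^T with w = (sqrt 11, sqrt 50, 0).  The
    eigenvalues mu of c D + K solve
      mu^3 - c (D_11 + D_22) mu^2 + mu - c D_11 = 0.
    The two entries D_11 = 11/84 and D_22 = 50/84 are determined by requiring
    the rational roots 1/7 for c = 1 and 1/2 for c = 2; the other two roots are
    then conjugate, with the real parts 7/24 and 10/21. *)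
Definition superlinear_factor : 'M[R]_3 :=
  mx3 (Num.sqrt 11) 0 0 (Num.sqrt 50) 0 0 0 0 0.

Local Notation overdamped := (rotating_gram rotation_generator overdamped_factor).
Local Notation superlinear := (rotating_gram rotation_generator superlinear_factor).

Lemma overdamped_gram s : s *: (overdamped_factor *m overdamped_factor^T) =
  mx3 (4 * s) 0 0 0 (5 * s) (3 * s) 0 (3 * s) (2 * s).
Proof.
apply/matrixP; do 2!apply: ord3P; rewrite !mxE !big_ord_recl !big_ord0 !mxE /=; ring.
Qed.

Lemma superlinear_gram s : s *: (superlinear_factor *m superlinear_factor^T) =
  mx3 (11 * s) (Num.sqrt 11 * Num.sqrt 50 * s) 0
      (Num.sqrt 11 * Num.sqrt 50 * s) (50 * s) 0 0 0 0.
Proof.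
have gram (p q : R) :
    s *: (mx3 p 0 0 q 0 0 0 0 0 *m (mx3 p 0 0 q 0 0 0 0 0)^T) =
    mx3 (p ^+ 2 * s) (p * q * s) 0 (p * q * s) (q ^+ 2 * s) 0 0 0 0.
  apply/matrixP; do 2!apply: ord3P;
    rewrite !mxE !big_ord_recl !big_ord0 !mxE /=; ring.
by rewrite gram !sqr_sqrtr.
Qed.

Lemma C_infty_overdamped0 : C_infty (overdamped 0) = 0.
Proof.
by rewrite (C_infty_complex_spectrum (l := 0) (p := 0) (N := 1)
  (overdamped_gram 0)) ?minxx //; lra.
Qed.

Lemma C_infty_overdamped1 : C_infty (overdamped 3^-1) = 2 / 3.
Proof.
apply: (C_infty_real_spectrum (l2 := 4 / 3) (l3 := 5 / 3) (overdamped_gram _)); lra.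
Qed.

Lemma C_infty_overdamped2 : C_infty (overdamped (2 * 3^-1)) = 1 / 3.
Proof.
apply: (C_infty_real_spectrum (l2 := 8 / 3) (l3 := 13 / 3) (overdamped_gram _)); lra.
Qed.

Lemma sqrt_product_sqr s : (Num.sqrt 11 * Num.sqrt 50 * s) ^+ 2 = 550 * s ^+ 2 :> R.
Proof. by rewrite !exprMn !sqr_sqrtr// -natrM. Qed.

Lemma C_infty_superlinear1 : C_infty (superlinear 84^-1) = 1 / 7.
Proof.
rewrite (C_infty_complex_spectrum (l := 1 / 7) (p := 7 / 24) (N := 11 / 12)
  (superlinear_gram _)) ?sqrt_product_sqr; try lra.
by apply/min_idPl; lra.
Qed.

Lemma C_infty_superlinear2 : C_infty (superlinear (2 * 84^-1)) = 10 / 21.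
Proof.
rewrite (C_infty_complex_spectrum (l := 1 / 2) (p := 10 / 21) (N := 11 / 21)
  (superlinear_gram _)) ?sqrt_product_sqr; try lra.
by apply/min_idPr; lra.
Qed.

(** The damping is left abstract, as only its rates matter. *)
Lemma superlinear_damping : exists v : M -> 'M[R[i]]_3,
  [/\ damping v, C_infty v = 1 / 7, C_infty (fun x => 2%:R *: v x) = 10 / 21 &
      C_infty (fun x => v x + v x) = 10 / 21].
Proof.
exists (superlinear 84^-1); split; first by apply: damping_rotating_gram; rewrite invr_ge0.
- exact: C_infty_superlinear1.
- by rewrite rotating_gram2; exact: C_infty_superlinear2.
by rewrite rotating_gramD; exact: C_infty_superlinear2.
Qed.

Lemma damping_overdamped s : 0 <= s -> damping (overdamped s).
Proof. exact: damping_rotating_gram. Qed.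

Lemma damping_le_overdamped s t : s <= t -> damping_le (overdamped s) (overdamped t).
Proof.
move=> st p; rewrite /rotating_gram -scalerBl -rmorphB.
by apply: psd_gram; rewrite subr_ge0.
Qed.

End Examples.

Theorem proposition4 (R : realType) :
  (exists (M : closedRiemannianManifold R) (n : nat), (0 < n)%N /\
     ~ C_infty_homogeneous M n /\ ~ C_infty_monotone M n) /\
  (exists (M : closedRiemannianManifold R) (n : nat) (a : M -> 'M[R[i]]_n),
     [/\ (0 < n)%N, damping a &
         C_infty (fun x => 2%:R *: a x) < C_infty a]) /\
  (exists (M : closedRiemannianManifold R) (n : nat) (a : M -> 'M[R[i]]_n),
     [/\ (0 < n)%N, damping a &
         2%:R * C_infty a < C_infty (fun x => 2%:R *: a x)]) /\
  (exists (M : closedRiemannianManifold R) (n : nat), (0 < n)%N /\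
     ~ C_infty_additive M n) /\
  (exists (M : closedRiemannianManifold R) (n : nat)
          (a b : M -> 'M[R[i]]_n),
     [/\ (0 < n)%N, damping a, damping b &
         C_infty (fun x => a x + b x) > C_infty a + C_infty b]) /\
  (exists (M : closedRiemannianManifold R) (n : nat)
          (a b : M -> 'M[R[i]]_n),
     [/\ (0 < n)%N, damping a, damping b &
         C_infty (fun x => a x + b x) < C_infty a + C_infty b]).
Proof.
have le0 : 0 <= 3^-1 :> R by lra.
have le01 : 3^-1 <= 2 * 3^-1 :> R by lra.
have ltw : 1 / 3 < 2 / 3 :> R by lra.
have w_pos : 0 < 2 / 3 :> R by lra.
have w_sub : 1 / 3 < 2 / 3 + 2 / 3 :> R by lra.
have w_hom : 1 / 3 != 2 * (2 / 3) :> R by lra.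
have v_hom : 2 * (1 / 7) < 10 / 21 :> R by lra.
have v_sup : 1 / 7 + 1 / 7 < 10 / 21 :> R by lra.
pose M := round_circle R.
pose w s := rotating_gram (rotation_generator R) (overdamped_factor R) s.
have w0 : damping (w 0) by exact: damping_overdamped.
have w1 : damping (w 3^-1) by exact: damping_overdamped.
have w2 : damping (w (2 * 3^-1)) by apply: damping_overdamped; exact: le_trans le01.
split; [|split; [|split; [|split; [|split]]]].
- exists M, 3; split=> //; split.
    move=> /(_ 2 (w 3^-1) (ler0n _ 2) w1)/eqP; rewrite rotating_gramZ.
    by rewrite C_infty_overdamped1 C_infty_overdamped2 (negbTE w_hom).
  case=> [/(_ _ _ w1 w2 (damping_le_overdamped le01))|/(_ _ _ w0 w1 (damping_le_overdamped le0))].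
    by rewrite C_infty_overdamped1 C_infty_overdamped2 leNgt ltw.
  by rewrite C_infty_overdamped0 C_infty_overdamped1 leNgt w_pos.
- exists M, 3, (w 3^-1); split=> //.
  by rewrite rotating_gram2 C_infty_overdamped1 C_infty_overdamped2.
- have [v [dv v1 v2 _]] := superlinear_damping R.
  by exists M, 3, v; split=> //; rewrite v1 v2.
- exists M, 3; split=> // /(_ (w 3^-1) (w 3^-1) w1 w1)/eqP; rewrite rotating_gramD.
  by rewrite C_infty_overdamped1 C_infty_overdamped2 lt_eqF.
- have [v [dv v1 _ vv]] := superlinear_damping R.
  by exists M, 3, v, v; split=> //; rewrite v1 vv.
exists M, 3, (w 3^-1), (w 3^-1); split=> //.
by rewrite rotating_gramD C_infty_overdamped1 C_infty_overdamped2.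
Qed.
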